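(* Let $d\ge 1$ and let $I$ be a positive Gorenstein ideal in $\mathbb{R}[x_1,x_2,x_3]$ with socle $\ell$ of degree $4d$. Then $I$ does not contain a strictly positive form of degree $2d+2$.
   Context: $\mathbb{R}[x]_{3,m}$ is the vector space of real forms of degree $m$ in $x_1,x_2,x_3$. For a nonzero linear functional $\ell:\mathbb{R}[x]_{3,4d}\to\mathbb{R}$, the Gorenstein ideal with socle $\ell$ (of degree $4d$) is the homogeneous ideal $I(\ell)$ of $\mathbb{R}[x_1,x_2,x_3]$ whose homogeneous elements are the forms $p$ with $\deg p>4d$, or with $\deg p\le 4d$ and $\ell(pq)=0$ for all $q\in\mathbb{R}[x]_{3,4d-\deg p}$. It is a positive Gorenstein ideal if $\ell(g^2)\ge 0$ for all $g\in\mathbb{R}[x]_{3,2d}$. A form $p$ is strictly positive if $p(x)>0$ for all $x\in\mathbb{R}^3\setminus\{0\}$. *)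

(* Defs.v *)
From HB Require Import structures.
From mathcomp Require Import all_boot all_order all_algebra.
From mathcomp Require Import boolp reals.
From mathcomp Require Import mpoly.

Set Implicit Arguments.
Unset Strict Implicit.
Unset Printing Implicit Defensive.

Import Order.TTheory GRing.Theory Num.Theory.

Local Open Scope ring_scope.

Notation "''Form[' R ]_ m" := (dhomog 3 R m)
  (at level 8, m at level 2, format "''Form[' R ]_ m").

Section GorensteinIdeals.
Variables (R : realType) (d : nat).
Implicit Types (l : {scalar 'Form[R]_(4 * d)}) (I : {pred {mpoly R[3]}}).

(* Meant for p homogeneous of degree k. In the second case p * q is then
   homogeneous of degree 4d, so indhomog returns p * q itself and not its
   default value 0. *)
Definition gorenstein_piece l (k : nat) (p : {mpoly R[3]}) : Prop :=
  (4 * d < k)%N \/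
  (k <= 4 * d)%N /\
    forall q : 'Form[R]_(4 * d - k),
      l (indhomog (4 * d) (p * mpoly_of_dhomog q)) = 0.

Definition homogeneous_ideal I : Prop :=
  idealr_closed I /\ forall p, p \in I -> forall k, pihomog mdeg k p \in I.

(* idealr_closed asks for a proper ideal; this excludes nothing, since
   1 \in I(l) would force l = 0. *)
Definition gorenstein_ideal l I : Prop :=
  [/\ exists f, l f != 0,
      homogeneous_ideal I
    & forall k p, p \is k.-homog -> p \in I <-> gorenstein_piece l k p].

Lemma gorenstein_ideal_ex l : (exists f, l f != 0) ->
  exists I, gorenstein_ideal l I.
Proof.
move=> lN0.
have valh k (p : {mpoly R[3]}) : p \is k.-homog -> val (indhomog k p) = p.
  by move=> hp; rewrite /indhomog insubdK.
have hhom k (q : 'Form[R]_k) : mpoly_of_dhomog q \is k.-homog.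
  exact: dhomog_is_dhomog.
have lD p q : p \is (4 * d).-homog -> q \is (4 * d).-homog ->
    l (indhomog (4 * d) (p + q)) =
    l (indhomog (4 * d) p) + l (indhomog (4 * d) q).
  move=> hp hq; rewrite -linearD; congr (l _); apply: val_inj.
  by rewrite /= valh ?rpredD //= -[LHS]/(p + q) -{1}(valh _ _ hp) -{1}(valh _ _ hq).
have l0 : l (indhomog (4 * d) 0) = 0.
  rewrite -[RHS](linear0 l); congr (l _); apply: val_inj.
  by rewrite valh ?rpred0.
have prodh k (p : {mpoly R[3]}) (q : {mpoly R[3]}) : (k <= 4 * d)%N ->
    p \is k.-homog -> q \is (4 * d - k).-homog -> p * q \is (4 * d).-homog.
  by move=> kd hp hq; rewrite -(subnKC kd); apply: dhomogM.
have piece0 k : gorenstein_piece l k 0.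
  case: (leqP k (4 * d)) => kd; [right|by left].
  by split=> // q; rewrite mul0r l0.
have pieceD k p q : p \is k.-homog -> q \is k.-homog ->
    gorenstein_piece l k p -> gorenstein_piece l k q ->
    gorenstein_piece l k (p + q).
  move=> hp hq; case: (leqP k (4 * d)) => kd; last by left.
  case=> [|[_ Hp]]; first by rewrite ltnNge kd.
  case=> [|[_ Hq]]; first by rewrite ltnNge kd.
  right; split=> // r; rewrite mulrDl lD ?Hp ?Hq ?addr0 //; exact: prodh (hhom _ _).
have pieceM i j p q : p \is i.-homog -> q \is j.-homog ->
    gorenstein_piece l j q -> gorenstein_piece l (i + j) (p * q).
  move=> hp hq; case: (leqP (i + j) (4 * d)) => ijd; last by left.
  have jd : (j <= 4 * d)%N by apply: leq_trans ijd; apply: leq_addl.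
  case=> [|[_ Hq]]; first by rewrite ltnNge jd.
  right; split=> // r.
  have hpr : p * mpoly_of_dhomog r \is (4 * d - j).-homog.
    have -> : (4 * d - j = i + (4 * d - (i + j)))%N.
      by rewrite subnDA subnAC subnKC // leq_subRL // addnC.
    exact: dhomogM (hhom _ _).
  have := Hq (indhomog (4 * d - j) (p * mpoly_of_dhomog r)).
  by rewrite -[mpoly_of_dhomog (indhomog _ _)]/(val _) valh // mulrCA mulrA.
pose G p := forall k, gorenstein_piece l k (pihomog mdeg k p).
have GD p q : G p -> G q -> G (p + q).
  by move=> Gp Gq k; rewrite linearD; apply: pieceD => //; apply: pihomogP.
have G0 : G 0 by move=> k; rewrite linear0.
have Ghom k p : p \is k.-homog -> gorenstein_piece l k p -> G p.
  move=> hp Hp j; have [<-|kj] := eqVneq k j; first by rewrite pihomog_dE.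
  by rewrite (pihomog_ne0 kj hp).
have GM p q : G q -> G (p * q).
  move=> Gq.
  rewrite (pihomog_partitionE (leqnn (mmeasure mdeg p))).
  rewrite (pihomog_partitionE (leqnn (mmeasure mdeg q))).
  rewrite mulr_suml; apply: (big_ind G) => // i _.
  rewrite mulr_sumr; apply: (big_ind G) => // j _.
  apply: (Ghom (i + j)%N); first by apply: dhomogM; apply: pihomogP.
  by apply: pieceM => //; apply: pihomogP.
pose IG : {pred {mpoly R[3]}} := fun p => `[< G p >].
have memE p : (p \in IG) = `[< G p >] by [].
exists IG; split => //; first split; first split.
- by rewrite memE; apply/asboolP.
- apply/negP; rewrite memE => /asboolP /(_ 0%N).
  rewrite pihomog_dE ?dhomog1 // => -[//|[_ H]].
  case: lN0 => f /eqP; apply.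
  have hf : mpoly_of_dhomog f \is (4 * d - 0).-homog by rewrite subn0; apply: hhom.
  have := H (indhomog (4 * d - 0) (mpoly_of_dhomog f)).
  rewrite mul1r -[X in indhomog _ X]/(val _) valh // => <-.
  by congr (l _); apply: val_inj; rewrite valh.
- move=> a p q; rewrite !memE => /asboolP Gp /asboolP Gq.
  by apply/asboolP; apply: GD => //; apply: GM.
- move=> p; rewrite memE => /asboolP Gp k; rewrite memE; apply/asboolP.
  exact: Ghom (pihomogP _ _ _) (Gp k).
- move=> k p hp; rewrite memE; split=> [/asboolP /(_ k)|Hp].
    by rewrite pihomog_dE.
  by apply/asboolP; apply: Ghom hp Hp.
Qed.

Lemma gorenstein_ideal_uniq l I J :
  gorenstein_ideal l I -> gorenstein_ideal l J -> I =i J.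
Proof.
suff sub I' J' : gorenstein_ideal l I' -> gorenstein_ideal l J' ->
    forall p, p \in I' -> p \in J'.
  by move=> hI hJ p; apply/idP/idP; apply: sub.
move=> [_ [_ gI] mI] [_ [cJ _] mJ] p pI.
have [J0 _ JD] := cJ.
rewrite (pihomog_partitionE (leqnn (mmeasure mdeg p))).
apply: (big_ind (fun q => q \in J')) => // [q r qJ rJ|k _].
  by rewrite -[q]mul1r; apply: JD.
apply/(mJ k); first exact: pihomogP.
by apply/mI; [exact: pihomogP | exact: gI].
Qed.

Definition positive_gorenstein_ideal l I : Prop :=
  gorenstein_ideal l I /\
  forall g : 'Form[R]_(2 * d), 0 <= l (indhomog (4 * d) (mpoly_of_dhomog g ^+ 2)).

Definition strictly_positive (p : {mpoly R[3]}) : Prop :=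
  forall x : 'I_3 -> R, (exists i, x i != 0) -> 0 < p.@[x].

End GorensteinIdeals.

(* Main.v *)
Require Import Defs.
From HB Require Import structures.
From mathcomp Require Import all_boot all_order all_algebra.
From mathcomp Require Import boolp classical_sets reals complex mpoly.
From mathcomp Require Import zify ring lra.

(* Put k = 2d and suppose that l vanishes on the multiples of a strictly
   positive form p of degree k + 2 and is nonnegative on squares of forms of
   degree k. Among such functionals take one whose Gram matrix on forms of degree
   k has minimal rank. If all forms in the radical W of l vanished at a common
   (complex, necessarily nonreal) point of the curve p = 0 on the line z = 0,
   real and imaginary part of the evaluation there could be subtracted from l to
   lower the rank. Hence some q in W is coprime to p on z = 0.

   After dehomogenizing, l extends to a functional L on R[x, y] that kills the
   ideal (p, q). Let A be the largest ideal in the kernel of L, B = R[x, y] / A,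
   and h(j) the dimension of the image in B of the polynomials of degree at most
   j, so that h(2k) = dim B. Since p has no real zero, B contains a square root J
   of -1. The form L(uv) is nondegenerate on B, positive semidefinite on the
   image V of the polynomials of degree at most k and negative semidefinite on J V,
   which forces 2 h(k) <= h(2k). On the other hand h(j) - h(j - 1) is the
   codimension j + 1 - i(j) of the top forms of A in the binary forms of degree j.
   Either i(j) = 0, or i grows by at least one at each step from j on; as A
   contains the coprime pair p, q, in both cases the increment of h at 2k + 1 - j
   is at most its increment at j for 1 <= j <= k. Summation gives
   h(2k) - h(k) <= h(k) - h(0), hence h(2k) < 2 h(k), a contradiction. *)

Set Implicit Arguments.
Unset Strict Implicit.
Unset Printing Implicit Defensive.

Import Order.TTheory GRing.Theory Num.Theory.
Local Open Scope ring_scope.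

(** * Square roots of -1 modulo ideals without real zeros *)

Section Univariate.
Variable R : rcfType.
Implicit Types (N : {poly R}) (z : R[i]).
Local Notation toC := (map_poly (real_complex R)).

Lemma Im_real_mul (x : R) z : complex.Im (x%:C%C * z) = x * complex.Im z.
Proof. by case: z => a b /=; rewrite mul0r addr0. Qed.

Lemma Re_real_mul (x : R) z : complex.Re (x%:C%C * z) = x * complex.Re z.
Proof. by case: z => a b /=; rewrite mul0r subr0. Qed.

Definition quadratic_of z : {poly R} :=
  ('X - (complex.Re z)%:P) ^+ 2 + ((complex.Im z) ^+ 2)%:P.

Lemma size_quadratic_of z : size (quadratic_of z) = 3.
Proof.
rewrite /quadratic_of size_polyDl size_exp_XsubC //.
by apply: leq_ltn_trans (size_polyC_leq1 _) _.
Qed.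

Lemma root_quadratic_of z (x : R) : complex.Im z != 0 ->
  ~~ root (quadratic_of z) x.
Proof.
move=> z0; rewrite rootE /quadratic_of !hornerE.
by rewrite paddr_eq0 ?sqr_ge0 // negb_and orbC expf_eq0 /= z0.
Qed.

Lemma quadratic_of_root z : root (toC (quadratic_of z)) z.
Proof.
rewrite rootE /quadratic_of rmorphD /= rmorphXn /= rmorphB /= map_polyX !map_polyC /=.
rewrite !hornerE /=; apply/eqP; case: z => a b.
by apply/eqP; rewrite eq_complex /=; apply/andP; split; apply/eqP; ring.
Qed.

(** The remainder has degree at most 1 and vanishes at [z]; since Im z is nonzero, imaginary and
    real parts kill its two coefficients. *)
Lemma quadratic_of_dvd N z : complex.Im z != 0 ->
  root (toC N) z -> quadratic_of z %| N.
Proof.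
move=> z0 Nz; rewrite /dvdp; set r := N %% _.
have sr : (size r <= 2)%N.
  have := ltn_modp N (quadratic_of z).
  by rewrite -size_poly_eq0 size_quadratic_of ltnS.
have rz : (toC r).[z] = 0.
  have /(congr1 toC) := divp_eq N (quadratic_of z).
  rewrite rmorphD rmorphM /= => /(congr1 (fun p => p.[z])).
  rewrite hornerD hornerM (rootP (quadratic_of_root z)) mulr0 add0r.
  by rewrite (rootP Nz).
have rE : r = (r`_1)%:P * 'X + (r`_0)%:P.
  apply/polyP=> -[|[|i]]; rewrite !(coefD, coefMX, coefC) /= ?add0r ?addr0 //.
  by rewrite nth_default // (leq_trans sr).
move: rz; rewrite rE rmorphD rmorphM /= map_polyX !map_polyC /= !hornerE => h.
have r1 : r`_1 = 0.
  have /(congr1 (@complex.Im R)) := h; rewrite raddfD /= Im_real_mul addr0.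
  by move/eqP; rewrite mulf_eq0 (negPf z0) orbF => /eqP.
have r0 : r`_0 = 0.
  by have /(congr1 (@complex.Re R)) := h; rewrite raddfD /= Re_real_mul r1 mul0r add0r.
by rewrite r1 r0 mul0r addr0.
Qed.

Lemma nonreal_root N : N != 0 -> (forall x, ~~ root N x) -> size N != 1 ->
  exists2 z, complex.Im z != 0 & root (toC N) z.
Proof.
move=> N0 Nr sN.
have [z Nz] : exists z, root (toC N) z.
  by apply/closed_rootP; rewrite size_map_poly.
exists z => //; apply/eqP => z0; have := Nr (complex.Re z).
have zE : z = (complex.Re z)%:C%C by case: z z0 {Nz} => a b /= ->.
by move: Nz; rewrite zE /root horner_map fmorph_eq0 => ->.
Qed.

(** A common factor of degree 1 would give the quadratic a real root. *)
Lemma coprimep_quadratic_of z (w : {poly R}) : complex.Im z != 0 ->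
  ~~ (quadratic_of z %| w) -> coprimep w (quadratic_of z).
Proof.
move=> z0 sw; set s := quadratic_of z in sw *.
have s0 : s != 0 by rewrite -size_poly_eq0 size_quadratic_of.
have gs : gcdp w s %| s := dvdp_gcdr _ _.
have g0 : gcdp w s != 0 by rewrite gcdp_eq0 negb_and s0 orbT.
have := dvdp_leq s0 gs; rewrite size_quadratic_of.
rewrite /coprimep; case E : (size _) => [|[|[|[|]]]] //.
- by move/eqP: E; rewrite size_poly_eq0 (negPf g0).
- have [x gx] := poly2_root E.
  by have := root_quadratic_of x z0; rewrite -/s (root_dvdp gs gx).
- have : gcdp w s %= s by rewrite -(dvdp_size_eqp gs) E size_quadratic_of.
  by move/eqp_dvdl => sE; rewrite -sE dvdp_gcdl in sw.
Qed.

(* Induction on N = M s with s = (t - Re z)^2 + (Im z)^2 for a nonreal root z.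
   If j^2 + 1 = M c, lifting j to j + M k modulo M s means solving
   M k^2 + 2 j k + c = 0 modulo s, a quadratic equation with discriminant
   4 (j^2 - M c) = -4; -1 has the square root (t - Re z) / Im z modulo s. *)
Lemma sqrtN1_mod N : N != 0 -> (forall x, ~~ root N x) ->
  exists j : {poly R}, N %| j ^+ 2 + 1.
Proof.
have [m] := ubnP (size N); elim: m N => // m IH N sN N0 Nr.
have [sN1|sN1] := eqVneq (size N) 1%N.
  by exists 0; move/eqP/size_poly1P: sN1 => [c c0 ->]; rewrite -alg_polyC dvdpZl // dvd1p.
have [z z0 Nz] := nonreal_root N0 Nr sN1.
set s := quadratic_of z.
have /dvdpP [M NE] : s %| N by apply: quadratic_of_dvd.
have s0 : s != 0 by rewrite -size_poly_eq0 size_quadratic_of.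
have M0 : M != 0 by apply: contraNneq N0 => M0; rewrite NE M0 mul0r.
have [||j Mj] := IH M _ M0.
- rewrite NE size_mul // size_quadratic_of !addnS /= addn0 ltnS in sN.
  exact: ltnW.
- by move=> x; apply: contra (Nr x); rewrite NE rootM => ->.
have /dvdpP [c cE] := Mj.
pose b := complex.Im z; pose a := complex.Re z.
pose io : {poly R} := (b^-1)%:P * ('X - a%:P).
have ioE : io ^+ 2 + 1 = (b^-2)%:P * s.
  rewrite /s /quadratic_of mulrDr -/a -/b -polyCM -exprVn -exprMn mulVf // expr1n.
  by rewrite /io exprMn rmorphXn.
(* [w] is j + io or j - io, whichever is invertible modulo s: dividing both, s would divide 2 io, of
   degree 1. With u inverse to w, the solution k = - c u of the quadratic equation needs no division
   by M, which may share the factor s. *)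
have [w wE wc] : exists2 w : {poly R}, (w - j) ^+ 2 = io ^+ 2 & coprimep w s.
  have [sw|sw] := boolP (s %| j + io); last first.
    exists (j + io); last exact: coprimep_quadratic_of.
    by rewrite addrAC subrr add0r.
  exists (j - io); last first.
    apply: coprimep_quadratic_of => //; apply/negP => sw'.
    have : s %| io *+ 2.
      have -> : io *+ 2 = (j + io) - (j - io) by ring.
      exact: dvdp_sub.
    have io0 : io *+ 2 != 0.
      by rewrite -scaler_nat scaler_eq0 pnatr_eq0 /= mulf_neq0 ?polyXsubC_eq0 // polyC_eq0 invr_eq0.
    move/(dvdp_leq io0); rewrite size_quadratic_of -scaler_nat size_scale ?pnatr_eq0 //.
    by rewrite /io mul_polyC size_scale ?invr_eq0 // size_XsubC.
  by rewrite addrAC subrr add0r sqrrN.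
have /Bezout_eq1_coprimepP [[u v] /= uvE] := wc.
exists (j + M * - (c * u)).
have -> : (j + M * - (c * u)) ^+ 2 + 1 =
  (j ^+ 2 + 1) - 2%:R * j * M * c * u + M ^+ 2 * c ^+ 2 * u ^+ 2.
  by ring.
rewrite cE NE.
have -> : c * M - 2%:R * j * M * c * u + M ^+ 2 * c ^+ 2 * u ^+ 2
   = M * (c * (1 - 2%:R * j * u + (c * M) * u ^+ 2)) by ring.
rewrite -cE; apply: dvdp_mul => //; apply: dvdp_mull.
have -> : 1 - 2%:R * j * u + (j ^+ 2 + 1) * u ^+ 2
  = (io ^+ 2 + 1) * u ^+ 2 + (1 - u * w) * (1 + u * w - 2%:R * j * u).
  by rewrite -wE; ring.
rewrite ioE; apply: dvdp_add.
  by apply: dvdp_mulr; apply: dvdp_mull.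
have -> : 1 - u * w = v * s by rewrite -uvE; ring.
by apply: dvdp_mulr; apply: dvdp_mull.
Qed.

Lemma real_roots_split (a : {poly R}) : a != 0 ->
  exists rs : seq R, exists2 b : {poly R},
    a = b * \prod_(r <- rs) ('X - r%:P) & forall x, ~~ root b x.
Proof.
have [m] := ubnP (size a); elim: m a => // m IH a sa a0.
have [[x ax]|nx] := pselect (exists x, root a x); last first.
  by exists [::], a; rewrite ?big_nil ?mulr1 // => x; apply/negP => ax; apply: nx; exists x.
have /factor_theorem [b bE] := ax.
have b0 : b != 0 by apply: contraNneq a0 => b0; rewrite bE b0 mul0r.
have [|//|rs [c cE cr]] := IH b.
  by move: sa; rewrite bE size_mul ?polyXsubC_eq0 // size_XsubC addn2.
by exists (x :: rs), c => //; rewrite bE cE big_cons mulrAC -mulrA [X in _ * X]mulrC.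
Qed.

Lemma map_polyC_prod (rs : seq R) :
  map_poly (polyC : R -> {poly R}) (\prod_(r <- rs) ('X - r%:P)) =
  \prod_(r <- rs) ('X - r%:P%:P).
Proof.
rewrite rmorph_prod; apply: eq_bigr => r _.
by rewrite rmorphB /= map_polyX map_polyC.
Qed.

(** Each p(x, r) is p modulo y - r; multiplying these congruences leaves a multiple of the product
    of the y - r plus a multiple of p. *)
Lemma prod_horner_ideal (p : {poly {poly R}}) (rs : seq R) :
  exists u v, (\prod_(r <- rs) p.[r%:P])%:P =
     u * \prod_(r <- rs) ('X - r%:P%:P) + v * p :> {poly {poly R}}.
Proof.
elim: rs => [|r rs [u [v IH]]].
  by exists 1, 0; rewrite !big_nil mul1r mul0r addr0.
have /factor_theorem [w wE] : root (p - (p.[r%:P])%:P) r%:P.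
  by rewrite rootE !hornerE subrr.
have hE : (p.[r%:P])%:P = p - w * ('X - r%:P%:P) by rewrite -wE; ring.
exists (- w * u), ((p - w * ('X - r%:P%:P)) * v + u * \prod_(r <- rs) ('X - r%:P%:P)).
by rewrite !big_cons polyCM IH hE; ring.
Qed.

(* Split a = b * a_r where a_r collects the real roots of a. Modulo b, a square
   root of -1 comes from [sqrtN1_mod]. Modulo a_r and p, the polynomial
   prod_r p(x, r) in x alone vanishes and has no real root, so [sqrtN1_mod]
   applies again; the two square roots are glued by the Chinese remainder
   theorem. *)
Lemma sqrtN1_mod_ideal (A : {poly {poly R}} -> Prop)
    (AD : forall F G, A F -> A G -> A (F + G))
    (AM : forall F G, A F -> A (G * F)) (p : {poly {poly R}}) (a : {poly R}) :
  a != 0 -> A (map_poly polyC a) -> A p -> (forall x y, p.[y%:P].[x] != 0) ->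
  exists j, A (j ^+ 2 + 1).
Proof.
move=> a0 Aa Ap pN0; have [rs [b aE br]] := real_roots_split a0.
set ar := \prod_(r <- rs) _ in aE.
have b0 : b != 0 by apply: contraNneq a0 => b0; rewrite aE b0 mul0r.
have cb : coprimep b ar.
  rewrite /ar; elim: (rs) => [|r s IHs]; first by rewrite big_nil coprimep1.
  by rewrite big_cons coprimepMr IHs andbT coprimep_XsubC.
have /Bezout_eq1_coprimepP [[u v] /= uv1] := cb.
have [j1 /dvdpP [c1 j1E]] := sqrtN1_mod b0 br.
pose N := \prod_(r <- rs) p.[r%:P].
have Nr x : ~~ root N x.
  rewrite rootE /N horner_prod prodf_seq_neq0; apply/allP => r _; exact: pN0.
have N0 : N != 0.
  by apply: contraTneq (Nr 0) => ->; rewrite negbK root0.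
have [j2 /dvdpP [c2 j2E]] := sqrtN1_mod N0 Nr.
have [s [t stE]] := prod_horner_ideal p rs.
pose L := map_poly (polyC : R -> {poly R}).
have LrE : L ar = \prod_(r <- rs) ('X - r%:P%:P) by exact: map_polyC_prod.
have AE : A (L b * L ar) by rewrite -rmorphM /= -aE.
have uvL : L u * L b + L v * L ar = 1 by rewrite -!rmorphM -rmorphD uv1 rmorph1.
have j1L : L j1 ^+ 2 + 1 = L c1 * L b.
  by rewrite -rmorphXn -(rmorph1 L) -rmorphD /= j1E rmorphM.
have j2L : (j2%:P) ^+ 2 + 1 = c2%:P * (s * L ar + t * p).
  by rewrite LrE -stE -polyCM -j2E polyCD polyC1 rmorphXn.
(* The factor v ar is 1 modulo b and 0 modulo ar, u b the other way round, and their product is a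
   multiple of a. *)
exists (L j1 * (L v * L ar) + j2%:P * (L u * L b)).
set e := L v * L ar in uvL *; set f := L u * L b in uvL *.
have -> : (L j1 * e + j2%:P * f) ^+ 2 + 1 =
  (L j1 ^+ 2 + 1) * e + (j2%:P ^+ 2 + 1) * f - (L j1 - j2%:P) ^+ 2 * (e * f).
  have -> : 1 = e + f :> {poly {poly R}} by rewrite addrC uvL.
  have fE : f = 1 - e by rewrite -uvL; ring.
  by rewrite fE; ring.
rewrite j1L j2L /e /f.
have -> : L c1 * L b * (L v * L ar) + c2%:P * (s * L ar + t * p) * (L u * L b) -
    (L j1 - j2%:P) ^+ 2 * (L v * L ar * (L u * L b)) =
  (L c1 * L v + c2%:P * s * L u - (L j1 - j2%:P) ^+ 2 * L v * L u) * (L b * L ar)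
  + (c2%:P * t * L u * L b) * p by ring.
by apply: AD; apply: AM.
Qed.

End Univariate.

(** * Positive semidefinite matrices *)

Section QuadraticForms.
Variable R : realFieldType.

Definition bform n (S : 'M[R]_n) (x y : 'rV[R]_n) : R := (x *m S *m y^T) 0 0.

Definition psdmx n (S : 'M[R]_n) := S^T = S /\ forall x, 0 <= bform S x x.

Lemma bformDl n (S : 'M[R]_n) x y z : bform S (x + y) z = bform S x z + bform S y z.
Proof. by rewrite /bform !mulmxDl mxE. Qed.

Lemma bformZl n (S : 'M[R]_n) a x z : bform S (a *: x) z = a * bform S x z.
Proof. by rewrite /bform -!scalemxAl mxE. Qed.

Lemma bformC n (S : 'M[R]_n) x y : S^T = S -> bform S x y = bform S y x.
Proof.
move=> St; rewrite /bform -[in RHS](trmxK (y *m S *m x^T)) [RHS]mxE.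
by rewrite !trmx_mul trmxK St mulmxA.
Qed.

Lemma bform_row n (S : 'M[R]_n) x j : bform S x (delta_mx 0 j) = (x *m S) 0 j.
Proof. by rewrite /bform trmx_delta -colE mxE. Qed.

Lemma bform_sum n (S : 'M[R]_n) x :
  bform S x x = \sum_i \sum_j S i j * (x 0 i * x 0 j).
Proof.
rewrite /bform mxE exchange_big; apply: eq_bigr => i _.
rewrite !mxE big_distrl; apply: eq_bigr => j _ /=; ring.
Qed.

Lemma bform_sub n (S T : 'M[R]_n) t x y :
  bform (S - t *: T) x y = bform S x y - t * bform T x y.
Proof. by rewrite /bform mulmxBr mulmxBl -scalemxAr -scalemxAl !mxE. Qed.

Lemma quadratic_disc (a c e : R) : 0 <= e ->
  (forall t, 0 <= a + 2%:R * c * t + e * t ^+ 2) -> c ^+ 2 <= a * e.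
Proof.
move=> e_ge0 H; have a0 : 0 <= a by have := H 0; lra.
have [e0|e0] := eqVneq e 0.
  suff -> : c = 0 by rewrite e0; lra.
  apply/eqP; apply: contraT => c0.
  have := H (- (a + 1) / (2%:R * c)).
  have -> : 2%:R * c * (- (a + 1) / (2%:R * c)) = - (a + 1) by field.
  by rewrite e0; lra.
have := H (- c / e).
have -> : a + 2%:R * c * (- c / e) + e * (- c / e) ^+ 2 = (a * e - c ^+ 2) / e by field.
have ep : 0 < e by rewrite lt_neqAle eq_sym e0.
by rewrite pmulr_lge0 ?invr_gt0 // subr_ge0.
Qed.

Lemma bform_CS n (S : 'M[R]_n) x y : psdmx S ->
  bform S x y ^+ 2 <= bform S x x * bform S y y.
Proof.
move=> [St Sp]; apply: quadratic_disc => // t.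
have -> : bform S x x + 2%:R * bform S x y * t + bform S y y * t ^+ 2 =
  bform S (x + t *: y) (x + t *: y).
  rewrite bformDl bformZl !(bformC _ (x + _) St) !bformDl !bformZl (bformC y x St).
  ring.
exact: Sp.
Qed.

Lemma psdmx_radical n (S : 'M[R]_n) x : psdmx S -> bform S x x = 0 -> x *m S = 0.
Proof.
move=> Sp xx; apply/rowP => j; rewrite -bform_row mxE.
have := bform_CS x (delta_mx 0 j) Sp; rewrite xx mul0r => h.
by apply/eqP; rewrite -sqrf_eq0 eq_le h sqr_ge0.
Qed.

(* T = S Z S for some Z, so that T(u, u) is at most a multiple of the squared
   length of u S; this length is controlled by S(u, u) because S^2 <= tr(S) S. *)
Lemma psdmx_dominates n (S T : 'M[R]_n) : psdmx S -> T^T = T ->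
  (kermx S <= kermx T)%MS -> exists2 c, 0 < c & forall u, bform T u u <= c * bform S u u.
Proof.
move=> Sp Tt ker; have [St Spos] := Sp.
have TS : (T <= S)%MS.
  rewrite submxE -trmx_eq0 trmx_mul Tt -sub_kermx (submx_trans _ ker) //.
  by rewrite sub_kermx -[X in _ *m X]St -trmx_mul mulmx_coker trmx0.
have [D DE] := submxP TS.
pose Z := D^T *m pinvmx S.
have TE : T = S *m Z *m S.
  have SD : S *m D^T = T by rewrite -Tt [in RHS]DE trmx_mul St.
  by rewrite /Z mulmxA SD mulmxKpV.
pose z := \sum_i \sum_j `|Z i j|.
have z0 : 0 <= z by apply: sumr_ge0 => i _; apply: sumr_ge0.
have tr0 : 0 <= \tr S.
  by apply: sumr_ge0 => i _; have := Spos (delta_mx 0 i); rewrite bform_row -rowE mxE.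
exists (z * \tr S + 1); first by have := mulr_ge0 z0 tr0; lra.
move=> u; pose w := u *m S.
have wj j : w 0 j ^+ 2 <= bform S u u * S j j.
  have := bform_CS u (delta_mx 0 j) Sp.
  by rewrite !bform_row -rowE [row _ _ _ _]mxE.
pose W := \sum_j w 0 j ^+ 2.
have WS : W <= bform S u u * \tr S.
  by rewrite /mxtrace mulr_sumr; apply: ler_sum => j _; apply: wj.
have wW j : w 0 j ^+ 2 <= W.
  rewrite /W (bigD1 j) //= lerDl; apply: sumr_ge0 => k _; exact: sqr_ge0.
have -> : bform T u u = bform Z w w.
  by rewrite /bform TE /w trmx_mul St !mulmxA.
have ZW : bform Z w w <= z * W.
  rewrite bform_sum /z mulr_suml; apply: ler_sum => i _.
  rewrite mulr_suml; apply: ler_sum => j _.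
  apply: le_trans (ler_norm _) _; rewrite normrM ler_wpM2l //.
  rewrite ler_norml; have := wW i; have := wW j.
  move: (w 0 i) (w 0 j) => a b; nra.
apply: le_trans ZW _.
have := ler_wpM2l z0 WS; have := Spos u; lra.
Qed.

Lemma symmetric_neq0 n (T : 'M[R]_n) : T^T = T -> T != 0 -> exists v, bform T v v != 0.
Proof.
move=> Tt T0; apply: contrapT => h.
have T0' v : bform T v v = 0 by apply/eqP; apply: contraT => hv; case: h; exists v.
case/eqP: T0; apply/matrixP => i j; rewrite mxE.
have := T0' (delta_mx 0 i + delta_mx 0 j).
rewrite bformDl !(bformC _ (delta_mx 0 i + _) Tt) !bformDl !T0' add0r addr0.
rewrite (bformC (delta_mx 0 j) _ Tt) -mulr2n bform_row -rowE mxE => /eqP.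
by rewrite mulrn_eq0 /= => /eqP.
Qed.

End QuadraticForms.

(** * Lowering the rank at the boundary of the semidefinite cone *)

Section ShiftPSD.
Variable R : realType.

(** Take the largest t that keeps S - t T semidefinite. Were the rank unchanged, the kernel would be
    that of S, so a multiple of S - t T would dominate T and t could still grow. *)
Lemma psdmx_shift_pos n (S T : 'M[R]_n) (v : 'rV_n) : psdmx S -> T^T = T ->
  (kermx S <= kermx T)%MS -> 0 < bform T v v ->
  exists t, psdmx (S - t *: T) /\ (\rank (S - t *: T)%R < \rank S)%N.
Proof.
move=> Sp Tt ker vT; have [St Spos] := Sp.
pose E : classical_sets.set R := fun t => 0 <= t /\ psdmx (S - t *: T).
have sym t : (S - t *: T)^T = S - t *: T by rewrite linearB linearZ /= St Tt.
have psd t : (forall x, t * bform T x x <= bform S x x) -> psdmx (S - t *: T).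
  by move=> h; split=> // x; rewrite bform_sub subr_ge0.
have E0 : E 0 by split=> //; apply: psd => x; rewrite mul0r.
have Eub x : 0 < bform T x x -> ubound E (bform S x x / bform T x x).
  move=> xT t [_ [_ /(_ x)]]; rewrite bform_sub subr_ge0 => h.
  by rewrite ler_pdivlMr.
have hs : has_sup E by split; [exists 0 | exists (bform S v v / bform T v v); apply: Eub].
pose s := sup E; have s0 : 0 <= s by apply: ub_le_sup E0; case: hs.
have sP : psdmx (S - s *: T).
  apply: psd => x; have [xT|xT] := ltP 0 (bform T x x); last first.
    by apply: le_trans (Spos x); rewrite mulr_ge0_le0.
  by rewrite -ler_pdivlMr //; apply: ge_sup; [exists 0 | apply: Eub].
exists s; split=> //; rewrite ltnNge; apply/negP => rk.
have kerS : (kermx S <= kermx (S - s *: T))%MS.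
  rewrite sub_kermx mulmxBr mulmx_ker -scalemxAr sub0r oppr_eq0.
  by move: ker; rewrite sub_kermx => /eqP ->; rewrite scaler0.
have kerS' : (kermx (S - s *: T) <= kermx S)%MS.
  rewrite -(mxrank_leqif_sup kerS) eqn_leq !mxrank_ker !leq_sub2l //.
  have := mxrankS kerS; rewrite !mxrank_ker.
  have := rank_leq_row S; have := rank_leq_row (S - s *: T).
  move: (\rank S) (\rank _) => a b; lia.
have [c c0 dom] := psdmx_dominates sP Tt (submx_trans kerS' ker).
have : E (s + c^-1).
  split; first by rewrite addr_ge0 // invr_ge0 ltW.
  apply: psd => x; have := dom x; rewrite bform_sub mulrDl.
  by rewrite mulrC -ler_pdivrMr // mulrC; lra.
move/(ub_le_sup (proj2 hs)); rewrite -/s gerDl.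
by rewrite leNgt invr_gt0 c0.
Qed.

Lemma psdmx_shift n (S T : 'M[R]_n) : psdmx S -> T^T = T ->
  (kermx S <= kermx T)%MS -> T != 0 ->
  exists t, psdmx (S - t *: T) /\ (\rank (S - t *: T)%R < \rank S)%N.
Proof.
move=> Sp Tt ker /(symmetric_neq0 Tt) [v]; rewrite neq_lt => /orP [vT|]; last first.
  exact: psdmx_shift_pos.
have [|||t] := @psdmx_shift_pos _ S (- T) v Sp.
- by rewrite linearN /= Tt.
- by rewrite sub_kermx mulmxN oppr_eq0 -sub_kermx.
- by rewrite /bform mulmxN mulNmx mxE oppr_gt0.
by rewrite scalerN -scaleNr => h; exists (- t).
Qed.

End ShiftPSD.

(** * Rank of a form on a semidefinite subspace *)

Section Signature.
Variable R : realFieldType.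

(** G induces a nondegenerate form modulo its radical, where orthogonal subspaces have complementary
    dimensions at most. *)
Lemma rank_pairing m1 m2 n (G : 'M[R]_n) (U : 'M_(m1, n)) (T : 'M_(m2, n)) :
  G^T = G -> U *m G *m T^T = 0 -> (\rank (U *m G) + \rank (T *m G) <= \rank G)%N.
Proof.
move=> Gt UT; have GE := mulmx_base G.
have -> : \rank (U *m G) = \rank (U *m col_base G).
  by rewrite -{1}GE mulmxA mxrankMfree // row_base_free.
have -> : \rank (T *m G) = \rank (row_base G *m T^T).
  rewrite -mxrank_tr trmx_mul Gt -{1}GE -mulmxA.
  by rewrite (eqmxMfull _ (col_base_full G)).
apply: mulmx0_rank_max.
by rewrite mulmxA -(mulmxA U) GE.
Qed.

(* rho acts on the quotient by the radical of G as a self-adjoint square root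
   of -1. On the span of P the form G is positive semidefinite and on that of P rho it
   is negative semidefinite, hence their intersection modulo the radical of G is
   orthogonal to both. *)
Lemma psd_rank_half m n (G rho : 'M[R]_n) (P : 'M_(m, n)) :
  G^T = G -> rho *m G = G *m rho^T -> rho *m rho *m G = - G ->
  psdmx (P *m G *m P^T) -> (2 * \rank (P *m G) <= \rank G)%N.
Proof.
move=> Gt rG rrG Pp; set A := P *m G; set B := P *m rho *m G.
have BE : B = A *m rho^T by rewrite /B /A -!mulmxA rG.
have AE : A = - (B *m rho^T).
  by rewrite /A /B -!mulmxA -rG !mulmxA -!(mulmxA P) rrG mulmxN opprK.
have rAB : \rank A = \rank B.
  apply/eqP; rewrite eqn_leq {1}AE mxrank_opp mxrankM_maxl /=.
  by rewrite BE mxrankM_maxl.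
have [U1 U1E] := submxP (capmxSl A B).
have [U2 U2E] := submxP (capmxSr A B).
have BPr : B *m (P *m rho)^T = - (A *m P^T).
  rewrite trmx_mul mulmxA {1}/B -!mulmxA (mulmxA G) -rG !mulmxA.
  by rewrite -(mulmxA P) -(mulmxA P) rrG mulmxN mulNmx.
have APr : A *m (P *m rho)^T = B *m P^T by rewrite trmx_mul mulmxA -BE.
have BPt : (B *m P^T)^T = B *m P^T.
  by rewrite trmx_mul trmxK [in LHS]BE trmx_mul trmxK /A trmx_mul Gt !mulmxA.
have [_ Ppos] := Pp.
have tr11 (Z : 'M[R]_1) : Z 0 0 = Z^T 0 0 by rewrite mxE.
(* Here x P and y P rho agree modulo the radical, so G(xP, xP) = G(yP rho, yP rho) = - G(yP, yP),
   and both ends vanish. *)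
have key (x y : 'rV_m) : x *m A = y *m B -> x *m A *m P^T = 0 /\ y *m A *m P^T = 0.
  move=> xy.
  have xx : bform (A *m P^T) x x = - bform (A *m P^T) y y.
    rewrite /bform mulmxA xy -(mulmxA y) tr11 [in LHS]trmx_mul trmxK.
    rewrite [in LHS]trmx_mul BPt (mulmxA x) -APr (mulmxA x A) xy -(mulmxA y) BPr.
    by rewrite mulmxN mulNmx mxE.
  have yy0 : bform (A *m P^T) y y = 0.
    by apply/eqP; rewrite eq_le Ppos -oppr_ge0 -xx Ppos.
  rewrite -(mulmxA x A) -(mulmxA y A); split; apply: psdmx_radical => //.
  by rewrite xx yy0 oppr0.
have U12 : U1 *m A = U2 *m B by rewrite -U1E -U2E.
have UA : U1 *m A *m P^T = 0 /\ U2 *m A *m P^T = 0.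
  split; apply/row_matrixP => i; rewrite !row_mul row0;
  by have [] := key (row i U1) (row i U2) _; rewrite -?row_mul ?U12.
have UT : U1 *m P *m G *m (col_mx P (P *m rho))^T = 0.
  rewrite -(mulmxA U1) -/A tr_col_mx mul_mx_row (proj1 UA) U12 -mulmxA BPr mulmxN mulmxA.
  by rewrite (proj2 UA) oppr0 row_mx0.
(* The ranks of the intersection and of the sum of A and B add up to twice the rank of A. *)
have := rank_pairing Gt UT.
rewrite -(mulmxA U1) -/A -U1E mul_col_mx -/A -/B -addsmxE addnC mxrank_sum_cap -rAB.
by rewrite mul2n -addnn.
Qed.

End Signature.

(** * Total degree on R[x][y] *)

Section Filtration.
Variable R : idomainType.
Local Notation S := {poly {poly R}}.
Implicit Types (F G : S) (T : {poly R}).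

(* x and y stand for 'X%:P and 'X in {poly {poly R}}. The blow-up F(t s, s),
   again read with inner variable t and outer variable s, turns the total degree
   in x, y into the degree in s; its coefficient of s^k is the form of degree k
   of F, dehomogenized by y = 1. *)
Definition blowup_x : {poly R} -> S :=
  horner_eval ('X%:P * 'X) \o map_poly (polyC \o polyC).
HB.instance Definition _ := GRing.RMorphism.on blowup_x.

Definition blowup : S -> S := horner_eval 'X \o map_poly blowup_x.
HB.instance Definition _ := GRing.RMorphism.on blowup.

Definition fil k F : bool := (size (blowup F) <= k.+1)%N.
Definition top k F : {poly R} := (blowup F)`_k.

Lemma coef_blowup_x T k : (blowup_x T)`_k = T`_k *: 'X^k.
Proof.
have -> : blowup_x T = \sum_(i < size T) (T`_i *: 'X^i)%:P * 'X^i.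
  rewrite /blowup_x /= /horner_eval (horner_coef_wide _ (size_poly _ _)).
  apply: eq_bigr => i _; rewrite coef_map /= exprMn -rmorphXn mulrA -polyCM.
  by rewrite -[in RHS]mul_polyC.
rewrite coef_sum; under eq_bigr do rewrite coefCM coefXn.
have [kT|kT] := ltnP k (size T).
  rewrite (bigD1 (Ordinal kT)) //= eqxx mulr1 big1 ?addr0 // => i.
  by rewrite -val_eqE /= eq_sym => /negPf ->; rewrite mulr0.
rewrite nth_default // scale0r big1 // => i _.
by rewrite gtn_eqF ?mulr0 // (leq_trans _ kT).
Qed.

Lemma coef_top k F j : (top k F)`_j = if (j <= k)%N then F`_(k - j)`_j else 0.
Proof.
have -> : top k F = \sum_(i < k.+1) F`_i`_(k - i) *: 'X^(k - i).
  rewrite /top /blowup /= /horner_eval.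
  rewrite (horner_coef_wide _ (leq_trans (size_poly _ _) (leq_maxl _ k.+1))).
  set m := maxn _ _; rewrite coef_sum.
  have km : (k.+1 <= m)%N by rewrite leq_maxr.
  rewrite -(subnKC km) big_split_ord /= [X in _ + X]big1 ?addr0; last first.
    by move=> i _; rewrite coefMXn /= ltn_addr.
  apply: eq_bigr => i _; rewrite coefMXn ltnNge -ltnS ltn_ord /=.
  by rewrite coef_map /= coef_blowup_x.
rewrite coef_sum; under eq_bigr do rewrite coefZ coefXn.
case: (leqP j k) => jk.
  have kj : (k - j < k.+1)%N by rewrite ltnS leq_subr.
  rewrite (bigD1 (Ordinal kj)) //= subKn // eqxx mulr1 big1 ?addr0 // => i.
  rewrite -val_eqE /= => ni; rewrite [j == _](_ : _ = false) ?mulr0 //.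
  by apply/negP => /eqP jE; case/eqP: ni; rewrite jE subKn // -ltnS.
by rewrite big1 // => i _; rewrite gtn_eqF ?mulr0 // (leq_ltn_trans (leq_subr _ _)).
Qed.

Lemma size_top k F : (size (top k F) <= k.+1)%N.
Proof. by apply/leq_sizeP => j kj; rewrite coef_top leqNgt kj. Qed.

Lemma filP k F : reflect (forall i j, (k < i + j)%N -> F`_i`_j = 0) (fil k F).
Proof.
apply: (iffP (leq_sizeP _ _)) => [h i j kij|h m km].
  by have := congr1 (fun q : {poly R} => q`_j) (h _ kij); rewrite -/(top _ _) coef_top leq_addl addnK coef0.
apply/polyP => j; rewrite -/(top _ _) coef_top coef0; case: leqP => // jm.
by rewrite h // subnK.
Qed.

Lemma filS k l F : (k <= l)%N -> fil k F -> fil l F.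
Proof. by move=> kl h; apply: leq_trans h _; rewrite ltnS. Qed.

Lemma fil0 k : fil k 0.
Proof. by rewrite /fil rmorph0 size_poly0. Qed.

Lemma filD k F G : fil k F -> fil k G -> fil k (F + G).
Proof.
rewrite /fil rmorphD => hF hG; apply: leq_trans (size_polyD _ _) _.
by rewrite geq_max hF.
Qed.

Lemma filN k F : fil k F -> fil k (- F).
Proof. by rewrite /fil rmorphN size_polyN. Qed.

Lemma filB k F G : fil k F -> fil k G -> fil k (F - G).
Proof. by move=> hF hG; apply: filD => //; apply: filN. Qed.

Lemma filM k l F G : fil k F -> fil l G -> fil (k + l) (F * G).
Proof.
rewrite /fil => hF hG; rewrite rmorphM; apply: leq_trans (size_polyMleq _ _) _.
move: hF hG; move: (size _) (size _) => a b; lia.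
Qed.

Lemma filC k c : fil k c%:P%:P.
Proof.
apply/filP => i j kij; rewrite coefC; case: eqP => i0; rewrite ?coef0 //.
by rewrite coefC; case: eqP => // j0; move: kij; rewrite i0 j0.
Qed.

Lemma filZ k c F : fil k F -> fil k (c%:P%:P * F).
Proof. by move=> hF; rewrite -[k]add0n filM // filC. Qed.

Lemma fil_ex F : exists k, fil k F.
Proof. by exists (size (blowup F)); rewrite /fil leqnSn. Qed.

Lemma topD k F G : top k (F + G) = top k F + top k G.
Proof. by rewrite /top rmorphD coefD. Qed.

Lemma topB k F G : top k (F - G) = top k F - top k G.
Proof. by rewrite /top rmorphB coefB. Qed.

Lemma topZ k c F : top k (c%:P%:P * F) = c *: top k F.
Proof.
apply/polyP => j; rewrite coefZ !coef_top; case: leqP => _; rewrite ?mulr0 //.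
by rewrite coefCM mul_polyC coefZ.
Qed.

Lemma top0 k : top k 0 = 0.
Proof. by rewrite /top rmorph0 coef0. Qed.

Lemma top_sum k I (r : seq I) (E : I -> S) :
  top k (\sum_(i <- r) E i) = \sum_(i <- r) top k (E i).
Proof. by apply: (big_morph (top k) (topD k) (top0 k)). Qed.

Lemma topM k l F G : fil k F -> fil l G -> top (k + l) (F * G) = top k F * top l G.
Proof.
rewrite /fil /top => /leq_sizeP hF /leq_sizeP hG; rewrite rmorphM coefM.
have kl : (k < (k + l).+1)%N by rewrite ltnS leq_addr.
rewrite (bigD1 (Ordinal kl)) //= addKn big1 ?addr0 // => i; rewrite -val_eqE /= => ik.
have [ki|ki] := ltnP k i; first by rewrite hF ?mul0r.
by rewrite [X in _ * X]hG ?mulr0 //; lia.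
Qed.

Lemma fil_top0 k F : fil k.+1 F -> top k.+1 F = 0 -> fil k F.
Proof.
move=> /leq_sizeP h h0; apply/leq_sizeP => j; rewrite leq_eqVlt => /predU1P [<-//|].
exact: h.
Qed.

Lemma fil_top_lt k l F : fil k F -> (k < l)%N -> top l F = 0.
Proof. by move=> /leq_sizeP h kl; apply: h. Qed.

(** The form y^k T(x / y), for T of degree at most k. *)
Definition hom k T : S := \poly_(i < k.+1) (T`_(k - i) *: 'X^(k - i)).

Lemma fil_hom k T : fil k (hom k T).
Proof.
apply/filP => i j kij; rewrite coef_poly ltnS; case: leqP => // ik; rewrite ?coef0 //.
by rewrite coefZ coefXn gtn_eqF ?mulr0 //; lia.
Qed.

Lemma top_hom k T : (size T <= k.+1)%N -> top k (hom k T) = T.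
Proof.
move=> /leq_sizeP sT; apply/polyP => j; rewrite coef_top; case: leqP => jk; last by rewrite sT.
by rewrite coef_poly ltnS leq_subr coefZ coefXn subKn // eqxx mulr1.
Qed.

Lemma filX : fil 1 'X.
Proof.
apply/filP => i j ij; rewrite coefX; case: eqP => i1; rewrite ?coef0 //.
by rewrite coefC; case: eqP => // j0; move: ij; rewrite i1 j0.
Qed.

Lemma filXC : fil 1 'X%:P.
Proof.
apply/filP => i j ij; rewrite coefC; case: eqP => i1; rewrite ?coef0 //.
by rewrite coefX; case: eqP => // j0; move: ij; rewrite i1 j0.
Qed.

Lemma topX : top 1 'X = 1.
Proof.
apply/polyP => -[|[|j]]; rewrite coef_top coef1 //= coefX /= ?coef1 ?coef0 //.
Qed.

Lemma topXC : top 1 'X%:P = 'X.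
Proof.
apply/polyP => -[|[|j]]; rewrite coef_top coefX //= coefC /= ?coefX ?coef0 //.
Qed.

Lemma filXM k F : fil k F -> fil k.+1 ('X * F).
Proof. exact: filM filX. Qed.

Lemma filXCM k F : fil k F -> fil k.+1 ('X%:P * F).
Proof. exact: filM filXC. Qed.

Lemma topXM k F : fil k F -> top k.+1 ('X * F) = top k F.
Proof. by move=> hF; rewrite (topM filX hF) topX mul1r. Qed.

Lemma topXCM k F : fil k F -> top k.+1 ('X%:P * F) = 'X * top k F.
Proof. by move=> hF; rewrite (topM filXC hF) topXC. Qed.

End Filtration.

#[global] Opaque fil top hom.

(** * Extending a functional to the quotient by two polynomials *)

Section Functionals.
Variable R : fieldType.
Local Notation S := {poly {poly R}}.
Implicit Types (lam : S -> R) (F G : S).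

(** Linearity over R: scalars enter as constant polynomials, because [*:] on [{poly {poly R}}]
    scales by [{poly R}]. *)
Definition linS lam := forall c F G, lam (c%:P%:P * F + G) = c * lam F + lam G.

Lemma linSD lam F G : linS lam -> lam (F + G) = lam F + lam G.
Proof. by move=> h; have := h 1 F G; rewrite !polyC1 !mul1r. Qed.

Lemma linS0 lam : linS lam -> lam 0 = 0.
Proof.
move=> h; have := linSD 0 0 h; rewrite addr0 => /eqP.
by rewrite -subr_eq0 opprD addNKr oppr_eq0 => /eqP.
Qed.

Lemma linSZ lam c F : linS lam -> lam (c%:P%:P * F) = c * lam F.
Proof. by move=> h; have := h c F 0; rewrite !addr0 linS0 // addr0. Qed.

Lemma linSN lam F : linS lam -> lam (- F) = - lam F.
Proof. by move=> h; have := linSZ (-1) F h; rewrite !polyCN !polyC1 !mulN1r. Qed.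

Lemma linSB lam F G : linS lam -> lam (F - G) = lam F - lam G.
Proof. by move=> h; rewrite linSD // linSN. Qed.

Lemma linS_sum lam I (r : seq I) (K : pred I) (E : I -> S) : linS lam ->
  lam (\sum_(i <- r | K i) E i) = \sum_(i <- r | K i) lam (E i).
Proof. by move=> h; apply: (big_morph lam (fun F G => linSD F G h) (linS0 h)). Qed.

End Functionals.

Section Extension.
Variable R : fieldType.
Local Notation S := {poly {poly R}}.
Variables (n m D : nat) (p q : S).
Hypotheses (n_gt1 : (1 < n)%N) (m_gt1 : (1 < m)%N) (DE : D.+2 = (n + m)%N).
Hypotheses (filp : fil n p) (filq : fil m q).
Local Notation P := (top n p).
Local Notation Q := (top m q).
Hypotheses (sizeP : size P = n.+1) (cPQ : coprimep P Q).

Let P0 : P != 0. Proof. by rewrite -size_poly_eq0 sizeP. Qed.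

(** Multiply a Bezout relation by T and reduce the cofactor of Q modulo P. Its degree is then below
    n, hence at most k - m because k > n + m - 2; the degree of the other cofactor follows. *)
Lemma coprime_spans k (T : {poly R}) : (D < k)%N -> (size T <= k.+1)%N ->
  exists a b, [/\ T = a * P + b * Q, (size a <= (k - n).+1)%N
    & (size b <= (k - m).+1)%N].
Proof.
move=> Dk sT; have /Bezout_eq1_coprimepP [[u v] /= uv1] := cPQ.
pose b : {poly R} := (T * v) %% P; pose c : {poly R} := (T * v) %/ P.
have bE : b = T * v - c * P by rewrite [T * v](divp_eq _ P) addrAC subrr add0r.
have sb : (size b <= n)%N by rewrite -ltnS -sizeP ltn_modp.
pose a : {poly R} := T * u + c * Q.
have TE : T = a * P + b * Q.
  by rewrite bE /a -[LHS]mulr1 -uv1; ring.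
have sQ : (size Q <= m.+1)%N := size_top _ _.
exists a, b; split=> //; last by apply: leq_trans sb _; lia.
have [->|a0] := eqVneq a 0; first by rewrite size_poly0.
have : (size (a * P)%R <= k.+1)%N.
  have -> : a * P = T - b * Q by rewrite TE addrK.
  apply: leq_trans (size_polyD _ _) _; rewrite geq_max sT size_polyN.
  apply: leq_trans (size_polyMleq _ _) _.
  by move: sb sQ; move: (size b) (size Q) => x y; lia.
by rewrite size_mul // sizeP; move: (size a) => x; lia.
Qed.

(** By [coprime_spans], top forms of degree above D are removed one degree at a time. *)
Lemma reduce_fil F : exists g a b, fil D g /\ F = g + a * p + b * q.
Proof.
have [k] := fil_ex F; elim: k F => [|k IH] F hF.
  by exists F, 0, 0; rewrite !mul0r !addr0 (filS _ hF).
have [kD|Dk] := leqP k.+1 D.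
  by exists F, 0, 0; rewrite !mul0r !addr0 (filS _ hF).
have [a [b [TE sa sb]]] := coprime_spans Dk (size_top k.+1 F).
pose a' := hom (k.+1 - n) a; pose b' := hom (k.+1 - m) b.
have kn : k.+1 = (k.+1 - n + n)%N by rewrite subnK //; lia.
have km : k.+1 = (k.+1 - m + m)%N by rewrite subnK //; lia.
have hF' : fil k (F - a' * p - b' * q).
  have h1 := filM (fil_hom (k.+1 - n) a) filp; rewrite -kn -/a' in h1.
  have h2 := filM (fil_hom (k.+1 - m) b) filq; rewrite -km -/b' in h2.
  apply: fil_top0; first by apply: filB h2; apply: filB.
  have t1 := topM (fil_hom (k.+1 - n) a) filp; rewrite -kn -/a' top_hom // in t1.
  have t2 := topM (fil_hom (k.+1 - m) b) filq; rewrite -km -/b' top_hom // in t2.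
  by rewrite !topB t1 t2 TE; ring.
have [g [c [e [hg gE]]]] := IH _ hF'.
exists g, (c + a'), (e + b'); split=> //.
have -> : F = (F - a' * p - b' * q) + a' * p + b' * q by ring.
by rewrite gE; ring.
Qed.

(* The top forms of a and b are a syzygy of the coprime pair (P, Q), hence a
   multiple of (Q, -P), and can be cancelled. *)
Lemma lower_cofactors k a b : (D <= k)%N -> fil (k - n) a -> fil (k - m) b ->
  fil D (a * p + b * q) -> exists a' b', [/\ fil (D - n) a', fil (D - m) b' &
    a * p + b * q = a' * p + b' * q].
Proof.
elim: k a b => [|k IH] a b Dk ha hb hab.
  by exists a, b; split=> //; [apply: filS ha|apply: filS hb]; lia.
have [kD|Dk'] := leqP k.+1 D.
  by exists a, b; split=> //; [apply: filS ha|apply: filS hb]; lia.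
have kn : k.+1 = (k.+1 - n + n)%N by rewrite subnK //; lia.
have km : k.+1 = (k.+1 - m + m)%N by rewrite subnK //; lia.
have kn' : (k.+1 - n = (k - n).+1)%N by lia.
have km' : (k.+1 - m = (k - m).+1)%N by lia.
set al := top (k.+1 - n) a; set be := top (k.+1 - m) b.
have tE : al * P + be * Q = 0.
  rewrite -!topM // -kn -km -topD; exact: fil_top_lt hab _.
have /dvdpP [g gE] : P %| be.
  rewrite -(Gauss_dvdpl _ cPQ) (_ : be * Q = - al * P) ?dvdp_mull //.
  by apply/eqP; rewrite -subr_eq0 mulNr opprK addrC tE.
have alE : al = - g * Q.
  apply/eqP; rewrite -subr_eq0 -(mulIr_eq0 _ (mulIf P0)); apply/eqP.
  by rewrite -tE gE; ring.
(* A nonzero g excludes k + 1 = n + m - 1 by its size, so the subtraction in [e] below is not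
   truncated. *)
have [g0|g0] := eqVneq g 0.
  apply: (IH _ _ _ _ _ hab) => //; apply: fil_top0; rewrite -?kn' -?km' //.
    by rewrite -/al alE g0 oppr0 mul0r.
  by rewrite -/be gE g0 mul0r.
have sg : (size g + n <= (k.+1 - m).+1)%N.
  have := size_top (k.+1 - m) b; rewrite -/be gE size_mul // sizeP.
  by move: (size g) (_ - _)%N => x y; lia.
have sg0 : (0 < size g)%N by rewrite lt0n size_poly_eq0.
have nk : (n <= k.+1 - m)%N by move: sg sg0; move: (size g) => x; lia.
have sge : (size g <= (k.+1 - m - n).+1)%N by move: sg nk; move: (size g) => x; lia.
pose e := (k.+1 - m - n)%N; pose h := hom e g.
have hh : fil e h := fil_hom _ _.
have hg : top e h = g by rewrite top_hom.
have en : (k.+1 - m = e + n)%N by rewrite /e; lia.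
have em : (k.+1 - n = e + m)%N by rewrite /e; lia.
have := IH (a + h * q) (b - h * p).
have -> : (a + h * q) * p + (b - h * p) * q = a * p + b * q by ring.
apply=> //; apply: fil_top0; rewrite -?kn' -?km'.
- by apply: filD => //; rewrite em; apply: filM.
- by rewrite topD -/al alE em topM // hg; ring.
- by apply: filB => //; rewrite en; apply: filM.
- by rewrite topB -/be gE en topM // hg; ring.
Qed.

Variable lam : S -> R.
Hypotheses (lam_lin : linS lam) (lamp : forall G, fil (D - n) G -> lam (p * G) = 0)
  (lamq : forall G, fil (D - m) G -> lam (q * G) = 0).

(** This makes the extension well defined: cofactors of any degree are lowered to degrees where
    [lam] is known to vanish. *)
Lemma lam_ideal a b : fil D (a * p + b * q) -> lam (a * p + b * q) = 0.
Proof.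
have [k1 h1] := fil_ex a; have [k2 h2] := fil_ex b => hab.
pose k := (D + n + m + k1 + k2)%N.
have [|||a' [b' [ha hb ->]]] := @lower_cofactors k a b _ _ _ hab.
- by rewrite /k; lia.
- by apply: filS h1; rewrite /k; lia.
- by apply: filS h2; rewrite /k; lia.
by rewrite linSD // mulrC lamp // mulrC lamq // addr0.
Qed.

(** L F is [lam] of a remainder of F of degree at most D; by [lam_ideal] the choice of remainder
    does not matter. *)
Lemma extend_functional : exists L : S -> R, [/\ linS L,
  forall F, fil D F -> L F = lam F, forall F, L (F * p) = 0
  & forall F, L (F * q) = 0].
Proof.
have /choice [g gP] : forall F, exists g, fil D g /\ exists a b, F = g + a * p + b * q.
  by move=> F; have [g [a [b [hg FE]]]] := reduce_fil F; exists g; split=> //; exists a, b.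
have gE F G : fil D G -> (exists a b, F = G + a * p + b * q) -> lam (g F) = lam G.
  move=> hG [a [b FE]]; have [hF [a' [b' FE']]] := gP F.
  move: (g F) hF FE' => f hf FE'.
  apply/eqP; rewrite -subr_eq0 -linSB //; apply/eqP.
  have E : f - G = (a - a') * p + (b - b') * q.
    have -> : f = F - a' * p - b' * q by rewrite FE'; ring.
    by rewrite FE; ring.
  by rewrite E; apply: lam_ideal; rewrite -E; apply: filB.
exists (fun F => lam (g F)); split.
- move=> c F G; have [hF [a [b FE]]] := gP F; have [hG [a' [b' GE]]] := gP G.
  rewrite -lam_lin; apply: gE; first by apply: filD => //; apply: filZ.
  exists (c%:P%:P * a + a'), (c%:P%:P * b + b').
  by move: (g F) (g G) FE GE => f f' -> ->; ring.
- by move=> F hF; apply: gE => //; exists 0, 0; ring.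
- move=> F; rewrite (gE _ 0) ?linS0 ?fil0 //; exists F, 0; ring.
- move=> F; rewrite (gE _ 0) ?linS0 ?fil0 //; exists 0, F; ring.
Qed.

End Extension.

(** * Coordinates and Gram matrices *)

Section Monomials.
Variable R : realFieldType.
Local Notation S := {poly {poly R}}.
Implicit Types (F G : S) (lam : S -> R).

Definition midx k := {x : 'I_k.+1 * 'I_k.+1 | (x.1 + x.2 <= k)%N}.
Definition nmon k := #|{: midx k}|.
(** The exponent of y comes first, then that of x, in the order of iterated coefficients. *)
Definition mexp k (a : 'I_(nmon k)) : nat * nat :=
  let x := val (enum_val a) in (x.1 : nat, x.2 : nat).

Lemma mexp_inj k : injective (@mexp k).
Proof.
move=> a b [h1 h2]; apply: enum_val_inj; apply: val_inj.
by rewrite [LHS]surjective_pairing [RHS]surjective_pairing; congr pair; apply: val_inj.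
Qed.

Lemma mexp_le k (a : 'I_(nmon k)) : ((mexp a).1 + (mexp a).2 <= k)%N.
Proof. exact: (valP (enum_val a)). Qed.

Lemma mexp_ex k i j : (i + j <= k)%N -> exists a : 'I_(nmon k), mexp a = (i, j).
Proof.
move=> ij; have ik : (i < k.+1)%N by rewrite ltnS (leq_trans _ ij) ?leq_addr.
have jk : (j < k.+1)%N by rewrite ltnS (leq_trans _ ij) ?leq_addl.
pose x : midx k := exist _ (Ordinal ik, Ordinal jk) ij.
by exists (enum_rank x); rewrite /mexp enum_rankK.
Qed.

Lemma coefZS c F i j : (c%:P%:P * F)`_i`_j = c * F`_i`_j.
Proof. by rewrite !coefCM. Qed.

Definition mono i j : S := ('X^j)%:P * 'X^i.

Lemma coef_mono i j i' j' : (mono i j)`_i'`_j' = ((i' == i) && (j' == j))%:R.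
Proof.
rewrite /mono mul_polyC coefZ coefXn; case: eqP => _ /=; rewrite ?mulr1 ?mulr0 ?coef0 //.
by rewrite coefXn.
Qed.

Lemma fil_mono k i j : (i + j <= k)%N -> fil k (mono i j).
Proof.
move=> ijk; apply/filP => i' j' h; rewrite coef_mono.
by case: eqP => // E1; case: eqP => // E2; move: h; rewrite E1 E2 ltnNge ijk.
Qed.

Lemma mono_mul i j i' j' : mono i j * mono i' j' = mono (i + i') (j + j').
Proof. by rewrite /mono mulrACA -polyCM -!exprD. Qed.

Definition mon k (a : 'I_(nmon k)) : S := mono (mexp a).1 (mexp a).2.
Lemma monE k (a : 'I_(nmon k)) : mon a = mono (mexp a).1 (mexp a).2.
Proof. by []. Qed.

Definition pol k (u : 'rV[R]_(nmon k)) : S := \sum_a (u 0 a)%:P%:P * mon a.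
Definition crd k F : 'rV[R]_(nmon k) := \row_a F`_(mexp a).1`_(mexp a).2.

Lemma polE k (u : 'rV[R]_(nmon k)) : pol u = \sum_a (u 0 a)%:P%:P * mon a.
Proof. by []. Qed.

Lemma crdE k F a : crd k F 0 a = F`_(mexp a).1`_(mexp a).2.
Proof. exact: mxE. Qed.

Lemma fil_mon k (a : 'I_(nmon k)) : fil k (mon a).
Proof. by apply: fil_mono; apply: mexp_le. Qed.

Lemma fil_pol k (u : 'rV[R]_(nmon k)) : fil k (pol u).
Proof.
rewrite /pol; apply: (big_ind (fun F => is_true (fil k F))) => [|F G|a _].
- exact: fil0.
- exact: filD.
- by apply: filZ; apply: fil_mon.
Qed.

Lemma polK k : cancel (@pol k) (@crd k).
Proof.
move=> u; apply/rowP => a; rewrite mxE /pol !coef_sum (bigD1 a) //= big1 => [|b ba].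
  by rewrite addr0 coefZS /mon coef_mono !eqxx mulr1.
rewrite coefZS /mon coef_mono; case: eqP => h1; rewrite ?mulr0 //.
case: eqP => h2; rewrite ?mulr0 //; case/eqP: ba; apply: mexp_inj.
by move: h1 h2; rewrite /mexp /= => -> ->.
Qed.

Lemma crdK k F : fil k F -> pol (crd k F) = F.
Proof.
move=> hF; have hP := fil_pol (crd k F).
apply/polyP => i; apply/polyP => j; have [ij|ij] := leqP (i + j) k; last first.
  by rewrite (filP _ _ hP) // (filP _ _ hF).
have [a aE] := mexp_ex ij; have := congr1 (fun u : 'rV_(nmon k) => u 0 a) (polK (crd k F)).
by rewrite !mxE aE.
Qed.

Lemma pol_lin k c (u v : 'rV[R]_(nmon k)) : pol (c *: u + v) = c%:P%:P * pol u + pol v.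
Proof.
rewrite /pol mulr_sumr -big_split; apply: eq_bigr => a _ /=.
by rewrite !mxE !polyCD !polyCM; ring.
Qed.

Lemma pol0 k : pol (0 : 'rV[R]_(nmon k)) = 0.
Proof. by rewrite /pol big1 // => a _; rewrite mxE !polyC0 mul0r. Qed.

Lemma pol_rows k m (E : 'I_m -> S) (u : 'rV[R]_m) : (forall i, fil k (E i)) ->
  pol (u *m \matrix_i crd k (E i)) = \sum_i (u 0 i)%:P%:P * E i.
Proof.
move=> hE; rewrite mulmx_sum_row.
have polD (x y : 'rV[R]_(nmon k)) : pol (x + y) = pol x + pol y.
  by rewrite -[x]scale1r pol_lin !polyC1 mul1r scale1r.
rewrite (big_morph _ polD (pol0 k)); apply: eq_bigr => i _; rewrite rowK.
by rewrite -[_ *: _]addr0 pol_lin pol0 addr0 crdK.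
Qed.

Definition gram k lam : 'M[R]_(nmon k) := \matrix_(a, b) lam (mon a * mon b).

Lemma gram_sym k lam : (gram k lam)^T = gram k lam.
Proof. by apply/matrixP => a b; rewrite !mxE mulrC. Qed.

Lemma gram_row k lam (u : 'rV_(nmon k)) b : linS lam ->
  (u *m gram k lam) 0 b = lam (pol u * mon b).
Proof.
move=> h; rewrite mxE /pol mulr_suml linS_sum //; apply: eq_bigr => a _.
by rewrite mxE -(mulrA (u 0 a)%:P%:P) linSZ.
Qed.

Lemma bform_gram k lam (u v : 'rV_(nmon k)) : linS lam ->
  bform (gram k lam) u v = lam (pol u * pol v).
Proof.
move=> h; rewrite /bform mxE [pol v]/pol mulr_sumr linS_sum //; apply: eq_bigr => b _.
by rewrite gram_row // [v^T _ _]mxE (mulrCA (pol u) (v 0 b)%:P%:P) linSZ // mulrC.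
Qed.

Lemma gram_radical k lam (u : 'rV_(nmon k)) : linS lam -> u *m gram k lam = 0 ->
  forall H, fil k H -> lam (pol u * H) = 0.
Proof.
move=> h u0 H hH; rewrite -(crdK hH) -bform_gram // /bform u0 mul0mx mxE //.
Qed.

Lemma radical_gram k lam (u : 'rV_(nmon k)) : linS lam ->
  (forall H, fil k H -> lam (pol u * H) = 0) -> u *m gram k lam = 0.
Proof.
by move=> h H; apply/rowP => b; rewrite gram_row // mxE H // fil_mon.
Qed.

(** A monomial of degree at most 2k is a product of two of degree at most k, so its value is a Gram
    entry. *)
Lemma gram_eq0 k l lam : linS lam -> l = (k + k)%N -> gram k lam = 0 ->
  forall F, fil l F -> lam F = 0.
Proof.
move=> h -> g0 F hF; rewrite -(crdK hF) /pol linS_sum // big1 // => a _.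
rewrite linSZ //; suff -> : lam (mon a) = 0 by rewrite mulr0.
have := mexp_le a; rewrite /mon; move: (mexp a) => [i j] /= ij.
pose i1 := minn i k; pose j1 := (k - i1)%N.
have [j2 [jE1 jE2]] : exists j2, (j2 <= j)%N /\ ((i1 + j2 <= k) && (i - i1 + (j - j2) <= k))%N.
  by exists (minn j (k - i1)); rewrite /i1; lia.
have -> : mono i j = mono i1 j2 * mono (i - i1) (j - j2).
  by rewrite mono_mul; congr mono; rewrite subnKC // geq_minl.
have /andP [/mexp_ex [b bE] /mexp_ex [c cE]] := jE2.
have := congr1 (fun M : 'M_(nmon k) => M b c) g0.
by rewrite !mxE /mon bE cE.
Qed.

Lemma linS_sub lam lam' t : linS lam -> linS lam' -> linS (fun F => lam F - t * lam' F).
Proof. by move=> h h' c F G; rewrite h h'; ring. Qed.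

Lemma gram_sub k lam lam' t : gram k (fun F => lam F - t * lam' F) = gram k lam - t *: gram k lam'.
Proof. by apply/matrixP => a b; rewrite !mxE. Qed.

End Monomials.

#[global] Opaque pol crd mon gram.

(** * Extremal functionals *)

Lemma nonroot_nat (R : rcfType) (g : {poly R[i]}) : g != 0 -> exists n : nat, ~~ root g n%:R.
Proof.
move=> g0; apply: contrapT => hn.
pose rs : seq R[i] := [seq n%:R | n <- iota 0 (size g)].
have u : uniq rs.
  by rewrite map_inj_uniq ?iota_uniq // => a b /eqP; rewrite eqr_nat => /eqP.
have := max_poly_roots g0 _ u; rewrite size_map size_iota ltnn => h.
apply: notF; apply: h; apply/allP => _ /mapP [n _ ->].
by apply: contraT => rn; case: hn; exists n.
Qed.

Section Extremal.
Variable R : realType.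
Local Notation S := {poly {poly R}}.
Implicit Types (F G H q : S) (lam : S -> R).
Local Notation toC := (map_poly (real_complex R)).
Variables (k : nat) (K : S -> Prop).

Definition feasible lam :=
  [/\ linS lam, forall F, K F -> lam F = 0, forall G, fil k G -> 0 <= lam (G * G)
    & exists2 F, fil (k + k) F & lam F != 0].

Definition radical lam q := fil k q /\ forall H, fil k H -> lam (q * H) = 0.

Lemma feasible_psd lam : feasible lam -> psdmx (gram k lam).
Proof.
case=> h _ pos _; split; first exact: gram_sym.
by move=> u; rewrite bform_gram // pos // fil_pol.
Qed.

Lemma radical_sub lam q q' t : linS lam -> radical lam q -> radical lam q' ->
  radical lam (q + t%:P%:P * q').
Proof.
move=> h [fq rq] [fq' rq']; split; first by apply: filD => //; apply: filZ.
move=> H hH; rewrite mulrDl -mulrA linSD // linSZ // rq // rq' //; ring.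
Qed.

(** In degree at most 2k, the radical determines the functional up to a factor, as on an extreme
    ray; [lam'] need not be positive. *)
Definition extremal lam := forall lam', linS lam' -> (forall F, K F -> lam' F = 0) ->
  (forall q, radical lam q -> forall H, fil k H -> lam' (q * H) = 0) ->
  exists c, forall F, fil (k + k) F -> lam' F = c * lam F.

(* A feasible functional whose Gram matrix has minimal rank is extremal: a
   violating lam' could be subtracted until the rank drops. *)
Lemma extremal_exists lam : feasible lam -> exists2 lam', feasible lam' & extremal lam'.
Proof.
have [m] := ubnP (\rank (gram k lam)); elim: m lam => // m IH lam; rewrite ltnS => rk fs.
have [ex|] := pselect (extremal lam); first by exists lam.
move=> /existsNP [lam' /not_implyP [h' /not_implyP [K' /not_implyP [r' nc]]]].
have [h Kl pos [F0 hF0 F0N]] := fs.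
have Mp := feasible_psd fs.
have ker : (kermx (gram k lam) <= kermx (gram k lam'))%MS.
  rewrite sub_kermx; apply/eqP/row_matrixP => i; rewrite row_mul row0.
  apply: radical_gram => // H hH; apply: r' => //; split; first exact: fil_pol.
  by apply: gram_radical => //; rewrite -row_mul mulmx_ker row0.
have M0 : gram k lam' != 0.
  apply/eqP => g0; apply: nc; exists 0 => F hF; rewrite mul0r.
  exact: (gram_eq0 h' (erefl _) g0).
have [t [tp trk]] := psdmx_shift Mp (gram_sym _ _) ker M0.
pose lt F := lam F - t * lam' F.
have hlt : linS lt by apply: linS_sub.
apply: (IH lt); first by rewrite gram_sub (leq_trans trk).
split=> //.
- by move=> F KF; rewrite /lt Kl // K' // mulr0 subr0.
- move=> G hG; rewrite -(crdK hG) -bform_gram //.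
  by rewrite gram_sub; case: tp.
apply: contrapT => hz; have z F : fil (k + k) F -> lam F = t * lam' F.
  move=> hF; apply/eqP; rewrite -subr_eq0; apply: contraT => hn; case: hz; exists F => //.
have t0 : t != 0 by apply: contraNneq F0N => t0; rewrite z // t0 mul0r.
by apply: nc; exists t^-1 => F hF; rewrite z // mulKf.
Qed.

(** Evaluation of the form of degree 2k of F at the point (z : 1 : 0) at infinity. *)
Definition evalC (z : R[i]) F := (toC (top (k + k) F)).[z].

Lemma evalC_lin z c F G : evalC z (c%:P%:P * F + G) = c%:C%C * evalC z F + evalC z G.
Proof.
by rewrite /evalC topD topZ -mul_polyC rmorphD rmorphM /= map_polyC /= !hornerE.
Qed.

Lemma evalC_Re_lin z : linS (fun F => complex.Re (evalC z F)).
Proof. by move=> c F G; rewrite evalC_lin raddfD /= Re_real_mul. Qed.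

Lemma evalC_Im_lin z : linS (fun F => complex.Im (evalC z F)).
Proof. by move=> c F G; rewrite evalC_lin raddfD /= Im_real_mul. Qed.

(* Otherwise both Re and Im of the evaluation at z would be multiples of lam. *)
Lemma radical_nonvanishing lam z : (0 < k)%N -> feasible lam -> extremal lam ->
  complex.Im z != 0 -> (forall F, K F -> evalC z F = 0) ->
  exists2 q, radical lam q & (toC (top k q)).[z] != 0.
Proof.
move=> k0 fs ex z0 Kz; apply: contrapT => nq.
have rz q : radical lam q -> forall H, fil k H -> evalC z (q * H) = 0.
  move=> rq H hH; rewrite /evalC topM ?rmorphM ?hornerM //; last by case: rq.
  suff -> : (toC (top k q)).[z] = 0 by rewrite mul0r.
  by apply/eqP; apply: contraT => hn; case: nq; exists q.
have [c cE] : exists c, forall F, fil (k + k) F -> complex.Re (evalC z F) = c * lam F.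
  apply: ex; first exact: evalC_Re_lin.
    by move=> F KF; rewrite Kz.
  by move=> q rq H hH; rewrite rz.
have [e eE] : exists c, forall F, fil (k + k) F -> complex.Im (evalC z F) = c * lam F.
  apply: ex; first exact: evalC_Im_lin.
    by move=> F KF; rewrite Kz.
  by move=> q rq H hH; rewrite rz.
(* The forms y^(2k) and x y^(2k-1) take the values 1 and z: the first gives [lam] a nonzero value
   and then e = 0, the second gives Im z = 0. *)
have h1 := fil_hom (k + k) (1 : {poly R}); have hX := fil_hom (k + k) ('X : {poly R}).
have E1 : evalC z (hom (k + k) 1) = 1.
  by rewrite /evalC top_hom ?rmorph1 ?hornerC // size_poly1.
have EX : evalC z (hom (k + k) 'X) = z.
  by rewrite /evalC top_hom ?map_polyX ?hornerX // size_polyX; lia.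
have := cE _ h1; rewrite E1 /= => c1.
have := eE _ h1; rewrite E1 /= => /esym/eqP; rewrite mulf_eq0 => /orP [/eqP e0|/eqP l0].
  by have := eE _ hX; rewrite EX e0 mul0r => /eqP; rewrite (negPf z0).
by move/eqP: c1; rewrite l0 mulr0 oner_eq0.
Qed.

(** If q works for [zs] and q' for z, then q + n q' works for all of them once n avoids the finitely
    many roots of a nonzero polynomial. *)
Lemma radical_avoid lam (zs : seq R[i]) : linS lam ->
  (forall z, z \in zs -> exists2 q, radical lam q & (toC (top k q)).[z] != 0) ->
  exists2 q, radical lam q & forall z, z \in zs -> (toC (top k q)).[z] != 0.
Proof.
move=> h; elim: zs => [|z zs IH] H.
  exists 0 => //; split; first exact: fil0.
  by move=> G _; rewrite mul0r linS0.
have [|q rq qz] := IH; first by move=> w hw; apply: H; rewrite inE hw orbT.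
have [|q' rq' qz'] := H z; first by rewrite inE eqxx.
pose ev (f : S) w := (toC (top k f)).[w].
pose g := \prod_(w <- z :: zs) ((ev q w)%:P + 'X * (ev q' w)%:P).
have g0 : g != 0.
  rewrite prodf_seq_neq0; apply/allP => w; rewrite inE => wz /=.
  apply/eqP => fw.
  have e0 : ev q w = 0.
    by have := congr1 (fun f : {poly _} => f`_0) fw; rewrite coefD coefC coefXM coef0 /= addr0.
  have e1 : ev q' w = 0.
    by have := congr1 (fun f : {poly _} => f`_1) fw;
       rewrite coefD coefC coefXM coefC coef0 /= add0r.
  case/orP: wz => [/eqP wz|wz]; first by move: qz'; rewrite -wz -/(ev q' w) e1 eqxx.
  by have := qz w wz; rewrite -/(ev q w) e0 eqxx.
have [n ng] := nonroot_nat g0.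
exists (q + (n%:R)%:P%:P * q'); first exact: radical_sub.
move=> w wz; move: ng; rewrite rootE horner_prod prodf_seq_neq0 => /allP /(_ w wz) /=.
rewrite !hornerE topD topZ -mul_polyC rmorphD rmorphM /= map_polyC /= !hornerE.
by rewrite rmorph_nat.
Qed.

(** All complex roots of P are nonreal, so one q in the radical has a top form vanishing at none of
    them; coprimality is then tested over the complex numbers. *)
Lemma radical_coprime lam (P : {poly R}) : (0 < k)%N -> feasible lam -> extremal lam ->
  P != 0 -> (forall x, ~~ root P x) ->
  (forall z, root (toC P) z -> forall F, K F -> evalC z F = 0) ->
  exists2 q, radical lam q & coprimep P (top k q).
Proof.
move=> k0 fs ex P0 Pr KP; have [rs rsE] := closed_field_poly_normal (toC P).
have rsP z : z \in rs -> root (toC P) z.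
  move=> zr; rewrite rsE /root hornerZ mulf_eq0 -/(root _ z) root_prod_XsubC zr orbT //.
have [|q rq qz] := @radical_avoid lam rs (let: And4 h _ _ _ := fs in h).
  move=> z /rsP rz; apply: radical_nonvanishing => //; last exact: KP.
  apply/eqP => z0; have := Pr (complex.Re z); apply/negP; rewrite negbK.
  have zE : z = (complex.Re z)%:C%C by case: z z0 {rz} => a b /= ->.
  by move: rz; rewrite zE /root horner_map fmorph_eq0.
exists q => //; rewrite -(coprimep_map (real_complex R)) rsE.
rewrite coprimepZl ?lead_coef_eq0 ?map_poly_eq0 //.
elim: rs qz {rsE rsP} => [|z zs IH] qz; first by rewrite big_nil coprime1p.
rewrite big_cons coprimepMl coprimep_sym coprimep_XsubC.
rewrite IH ?andbT; last by move=> w wz; apply: qz; rewrite inE wz orbT.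
by apply: qz; rewrite inE eqxx.
Qed.

End Extremal.

(** * Hilbert function of the quotient by the annihilator *)

Lemma sub_mulmxP (R : fieldType) m1 m2 m3 (w : 'rV[R]_m3) (U : 'M[R]_(m1, m2)) (T : 'M_(m2, m3)) :
  (w <= U *m T)%MS <-> exists2 u : 'rV_m2, (u <= U)%MS & w = u *m T.
Proof.
split=> [/submxP [v ->]|[u uU ->]]; last exact: submxMr.
by exists (v *m U); rewrite ?submxMl ?mulmxA.
Qed.

Section Quotient.
Variable R : rcfType.
Local Notation S := {poly {poly R}}.
Implicit Types (F H : S) (T : {poly R}).
Variables (k : nat) (L : S -> R) (p q : S).
Local Notation D := (k + k)%N.
Local Notation n := k.+2.
Hypotheses (k_gt1 : (1 < k)%N) (filp : fil n p) (filq : fil k q).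
Hypotheses (sizeP : size (top n p) = n.+1) (cPQ : coprimep (top n p) (top k q)).
Hypotheses (Llin : linS L) (Lp : forall F, L (F * p) = 0) (Lq : forall F, L (F * q) = 0).
Hypothesis L_neq0 : exists F, L F != 0.

Definition annih F := forall H, L (F * H) = 0.
Local Notation A := annih.

Lemma annihD F H : A F -> A H -> A (F + H).
Proof. by move=> aF aH E; rewrite mulrDl linSD // aF aH addr0. Qed.

Lemma annihM F H : A F -> A (H * F).
Proof. by move=> aF E; rewrite (mulrC H) -mulrA. Qed.

Lemma annih0 : A 0.
Proof. by move=> E; rewrite mul0r linS0. Qed.

Lemma annihp : A p.
Proof. by move=> F; rewrite mulrC. Qed.

Lemma annihq : A q.
Proof. by move=> F; rewrite mulrC. Qed.

Lemma annih_reduce F : exists g, fil D g /\ A (F - g).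
Proof.
have n1 : (1 < n)%N by [].
have DE : D.+2 = (n + k)%N by lia.
have [g [a [b [hg ->]]]] := reduce_fil n1 k_gt1 DE filp filq sizeP cPQ F.
exists g; split=> //.
have -> : g + a * p + b * q - g = a * p + b * q by ring.
by apply: annihD; apply: annihM; [exact: annihp | exact: annihq].
Qed.

Local Notation N := (nmon D).
Local Notation G := (gram D L).

(** Every H has a representative of degree at most D modulo A, so testing in these degrees suffices.
    Hence the rank of [G] is the dimension of R[x, y] / A. *)
Lemma annih_gram (u : 'rV_N) : u *m G = 0 <-> A (pol u).
Proof.
split=> [u0 H|aH]; last by apply: radical_gram => // H _; apply: aH.
have [g [hg ag]] := annih_reduce H.
have -> : pol u * H = (H - g) * pol u + pol u * g by ring.
by rewrite linSD // ag (gram_radical Llin u0 hg) addr0.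
Qed.

Definition filmx j : 'M[R]_N :=
  diag_mx (\row_a (((mexp a).1 + (mexp a).2 <= j)%N)%:R).

Lemma filmxP j (u : 'rV_N) : reflect (fil j (pol u)) (u <= filmx j)%MS.
Proof.
apply: (iffP idP) => [/submxP [v ->]|hf].
  apply/filP => i l il; have := fil_pol (v *m filmx j).
  have [ilD|ilD] := leqP (i + l) D; last by move/filP; apply.
  have [a aE] := mexp_ex ilD; move=> _.
  have := congr1 (fun w : 'rV_N => w 0 a) (polK (v *m filmx j)).
  by rewrite crdE aE /= => ->; rewrite mul_mx_diag !mxE aE /= leqNgt il mulr0.
apply/submxP; exists u; apply/rowP => a; rewrite mul_mx_diag !mxE.
case: leqP => h; rewrite ?mulr1 // mulr0.
have := congr1 (fun w : 'rV_N => w 0 a) (polK u); rewrite crdE => <-.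
exact: (filP _ _ hf).
Qed.

Definition topmx j : 'M[R]_(N, D.+1) := \matrix_a poly_rV (top j (mon R a)).

Lemma mul_topmx j (u : 'rV_N) : u *m topmx j = poly_rV (top j (pol u)).
Proof.
rewrite mulmx_sum_row polE top_sum linear_sum.
by apply: eq_bigr => a _; rewrite rowK topZ linearZ.
Qed.

Definition kermx_fil j := (filmx j :&: kermx G)%MS.
(** Its row space consists of the top forms of degree j of A; for j at most D its rank is the number
    i(j). *)
Definition topideal j : 'M[R]_(N, D.+1) := kermx_fil j *m topmx j.

Lemma kermx_filP j (u : 'rV_N) :
  (u <= kermx_fil j)%MS <-> fil j (pol u) /\ A (pol u).
Proof.
rewrite sub_capmx sub_kermx; split=> [/andP [/filmxP hf /eqP /annih_gram ha] //|[hf ha]].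
by apply/andP; split; [apply/filmxP | apply/eqP/annih_gram].
Qed.

Lemma topidealP j (w : 'rV_(D.+1)) : (j <= D)%N ->
  (w <= topideal j)%MS <-> exists F, [/\ fil j F, A F & w = poly_rV (top j F)].
Proof.
move=> jD; rewrite /topideal; split=> [/sub_mulmxP [u /kermx_filP [hf ha] ->]|].
  by exists (pol u); rewrite mul_topmx.
case=> F [hf ha ->]; apply/sub_mulmxP.
have FE := crdK (filS jD hf).
by exists (crd D F); [apply/kermx_filP; rewrite FE | rewrite mul_topmx FE].
Qed.

Lemma filmx_ker j : (0 < j)%N -> (filmx j :&: kermx (topmx j) :=: filmx j.-1)%MS.
Proof.
case: j => // j _; apply/eqmxP/andP; split; apply/row_subP => i.
  have := row_sub i (filmx j.+1 :&: kermx (topmx j.+1))%MS; move: (row _ _) => u.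
  rewrite sub_capmx sub_kermx mul_topmx => /andP [/filmxP hf /eqP ht].
  apply/filmxP; apply: fil_top0 => //; have [jD|jD] := leqP j.+1 D.
    by have := congr1 rVpoly ht; rewrite poly_rV_K ?linear0 // (leq_trans (size_top _ _)).
  exact: fil_top_lt (fil_pol u) jD.
have := row_sub i (filmx j); move: (row _ _) => u /filmxP hf.
rewrite sub_capmx sub_kermx mul_topmx (fil_top_lt hf) // linear0 eqxx andbT.
by apply/filmxP; apply: filS hf.
Qed.

Lemma kermx_fil_ker j : (0 < j)%N ->
  (kermx_fil j :&: kermx (topmx j) :=: kermx_fil j.-1)%MS.
Proof.
move=> j0; rewrite /kermx_fil -capmxA (capmxC (kermx G)) capmxA.
exact: cap_eqmx (filmx_ker j0) (eqmx_refl _).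
Qed.

(* Dimension of the image of [fil j] in the quotient by [annih]. *)
Definition hilb j := \rank (filmx j *m G).

Lemma rank_filmx_top j : (j <= D)%N -> \rank (filmx j *m topmx j) = j.+1.
Proof.
move=> jD; pose E : 'M[R]_(j.+1, D.+1) := \matrix_(i, l) (val i == val l)%:R.
have Efree : row_free E.
  apply: inj_row_free => v vE; apply/rowP => i.
  have iD : (i < D.+1)%N by apply: leq_trans (ltn_ord i) _.
  have := congr1 (fun w : 'rV_(D.+1) => w 0 (Ordinal iD)) vE.
  rewrite !mxE (bigD1 i) //= mxE /= eqxx mulr1 big1 ?addr0 // => l li.
  by rewrite mxE /= [_ == _](_ : _ = false) ?mulr0 //; apply: negPf li.
have EE : (filmx j *m topmx j :=: E)%MS.
  apply/eqmxP/andP; split; apply/row_subP => i.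
    have := row_sub i (filmx j *m topmx j); move: (row i _) => w.
    case/sub_mulmxP => u /filmxP hf ->; rewrite mul_topmx.
    apply/submxP; exists (poly_rV (top j (pol u))); apply/rowP => l.
    rewrite !mxE; have [lj|lj] := ltnP l j.+1.
      rewrite (bigD1 (Ordinal lj)) //= !mxE eqxx mulr1 big1 ?addr0 // => l' ll.
      by rewrite !mxE [_ == _](_ : _ = false) ?mulr0 //; apply: negPf ll.
    rewrite big1 => [|l' _]; first by rewrite nth_default // (leq_trans (size_top _ _)).
    by rewrite !mxE ltn_eqF ?mulr0 // (leq_trans (ltn_ord l')).
  apply/sub_mulmxP; have hf := fil_hom j ('X^i : {poly R}).
  have FE := crdK (filS jD hf); exists (crd D (hom j 'X^i)).
    by apply/filmxP; rewrite FE.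
  rewrite mul_topmx FE top_hom ?size_polyXn //.
  by apply/rowP => l; rewrite !mxE coefXn eq_sym.
by rewrite EE; apply/eqP.
Qed.

(** Rank-nullity for [G] in degrees j and j - 1, and for the top form map on [filmx j] and on its
    part in A; the kernels of the latter are the same spaces for j - 1. *)
Lemma hilb_step j : (0 < j <= D)%N -> (hilb j + \rank (topideal j) = hilb j.-1 + j.+1)%N.
Proof.
case/andP => j0 jD.
have h1 := mxrank_mul_ker (filmx j) G; have h2 := mxrank_mul_ker (filmx j.-1) G.
have h3 := mxrank_mul_ker (filmx j) (topmx j).
have h4 := mxrank_mul_ker (kermx_fil j) (topmx j).
rewrite (filmx_ker j0) rank_filmx_top // in h3; rewrite (kermx_fil_ker j0) in h4.
rewrite -/(hilb j) -/(kermx_fil j) in h1; rewrite -/(hilb j.-1) -/(kermx_fil j.-1) in h2.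
rewrite -/(topideal j) in h4.
move: h1 h2 h3 h4; move: (\rank _) (\rank (filmx j)) (\rank _) (\rank _) (\rank _) => a b c e f; lia.
Qed.

(* [topideal j.+1] contains I and t I for I = [topideal j], and a nonzero finite
   dimensional space of polynomials is not stable under multiplication by t. *)
Lemma topideal_grow j : (j < D)%N -> topideal j != 0 ->
  (\rank (topideal j) < \rank (topideal j.+1))%N.
Proof.
move=> jD I0; have jD' := ltnW jD.
have sub : (topideal j <= topideal j.+1)%MS.
  apply/row_subP => i; have := row_sub i (topideal j); move: (row _ _) => w.
  case/(topidealP _ jD') => F [hf ha ->]; apply/(topidealP _ jD).
  by exists ('X * F); split; [exact: filXM | exact: annihM | rewrite topXM].
rewrite ltnNge; apply/negP => rk.
have sub' : (topideal j.+1 <= topideal j)%MS.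
  by rewrite -(mxrank_leqif_sup sub) eqn_leq rk mxrankS.
case/rowV0Pn: I0 => w /(topidealP _ jD') [F0 [hf0 ha0 ->]] T0.
have grow t : exists F, [/\ fil j F, A F & top j F = 'X^t * top j F0].
  elim: t => [|t [F [hf ha tF]]]; first by exists F0; rewrite expr0 mul1r.
  have tX : top j.+1 ('X%:P * F) = 'X^(t.+1) * top j F0.
    by rewrite (topXCM hf) tF exprS mulrA.
  have : (poly_rV (top j.+1 ('X%:P * F)) <= topideal j)%MS.
    apply: submx_trans sub'; apply/(topidealP _ jD); exists ('X%:P * F).
    by split; [exact: filXCM | exact: annihM |].
  case/(topidealP _ jD') => F' [hf' ha' /(congr1 rVpoly)].
  rewrite !poly_rV_K ?(leq_trans (size_top _ _)) ?ltnS // => FF'.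
  by exists F'; rewrite -FF' tX.
have [F [_ _ FE]] := grow j.+1.
have TN : top j F0 != 0 by apply: contraNneq T0 => ->; rewrite linear0.
have X0 : 'X^(j.+1) != 0 :> {poly R} by rewrite -size_poly_eq0 size_polyXn.
have := size_top j F; rewrite FE size_mul // size_polyXn.
have : (0 < size (top j F0))%N by rewrite lt0n size_poly_eq0.
by move: (size _) => s h1 h2; clear -h1 h2; lia.
Qed.

(* The products t^a Q and t^b P are independent, Q and P being coprime. *)
Lemma rank_topideal_coprime j : (k <= j)%N -> (j <= D)%N ->
  ((j - k).+1 + (j.+1 - n) <= \rank (topideal j))%N.
Proof.
move=> kj jD.
pose Mq : 'M[R]_((j - k).+1, D.+1) := \matrix_a poly_rV ('X^a * top k q).
pose Mp : 'M[R]_(j.+1 - n, D.+1) := \matrix_a poly_rV ('X^a * top n p).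
have sr m (x : 'rV[R]_m) : (size (rVpoly x) <= m)%N by apply: size_poly.
have rVE m (x : 'rV[R]_m) T : \sum_a x 0 a *: poly_rV ('X^a * T) =
    poly_rV (rVpoly x * T) :> 'rV[R]_(D.+1).
  rewrite /rVpoly poly_def mulr_suml linear_sum; apply: eq_bigr => a _.
  by rewrite valK -linearZ scalerAl.
have MqE (x : 'rV_((j - k).+1)) : x *m Mq = poly_rV (rVpoly x * top k q).
  by rewrite mulmx_sum_row -rVE; apply: eq_bigr => a _; rewrite rowK.
have MpE (x : 'rV_(j.+1 - n)) : x *m Mp = poly_rV (rVpoly x * top n p).
  by rewrite mulmx_sum_row -rVE; apply: eq_bigr => a _; rewrite rowK.
have sq (x : 'rV[R]_((j - k).+1)) : (size (rVpoly x * top k q)%R <= j.+1)%N.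
  apply: leq_trans (size_polyMleq _ _) _.
  have := size_top k q; have := sr _ x; move: (size _) (size _) => a b; lia.
have sp (x : 'rV[R]_(j.+1 - n)) : (size (rVpoly x * top n p)%R <= j.+1)%N.
  have [->|x0] := eqVneq (rVpoly x) 0; first by rewrite mul0r size_poly0.
  apply: leq_trans (size_polyMleq _ _) _; rewrite sizeP.
  have : (0 < size (rVpoly x))%N by rewrite lt0n size_poly_eq0.
  have := sr _ x; move: (size _) => a; lia.
have inI : (col_mx Mq Mp <= topideal j)%MS.
  rewrite col_mx_sub; apply/andP; split; apply/row_subP => a; rewrite rowK; apply/(topidealP _ jD).
    exists (hom (j - k) 'X^a * q); have jE : (j - k + k = j)%N by rewrite subnK.
    split; [by rewrite -{1}jE filM ?fil_hom | apply: annihM; exact: annihq |].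
    by rewrite -{2}jE topM ?fil_hom // top_hom // size_polyXn.
  have jn : (n <= j)%N by have := ltn_ord a; lia.
  exists (hom (j - n) 'X^a * p); have jE : (j - n + n = j)%N by rewrite subnK.
  split; [by rewrite -{1}jE filM ?fil_hom | apply: annihM; exact: annihp |].
  rewrite -{2}jE topM ?fil_hom // top_hom // size_polyXn.
  by have := ltn_ord a; lia.
suff free : row_free (col_mx Mq Mp).
  by apply: leq_trans (mxrankS inI); move/eqP: free => ->.
apply: inj_row_free => v; rewrite -(hsubmxK v) mul_row_col MqE MpE -linearD.
set x := rVpoly (lsubmx v); set y := rVpoly (rsubmx v) => /(congr1 rVpoly).
rewrite linear0 poly_rV_K => [xy0|]; last first.
  apply: leq_trans (size_polyD _ _) _; rewrite geq_max.
  by rewrite !(leq_trans (sq _)) ?(leq_trans (sp _)) // ltnS.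
have Px : top n p %| x.
  rewrite -(Gauss_dvdpl _ cPQ) (_ : x * _ = - y * top n p) ?dvdp_mull //.
  by apply/eqP; rewrite -subr_eq0 mulNr opprK xy0.
have x0 : x = 0.
  apply/eqP; apply: contraT => x0; have := dvdp_leq x0 Px; rewrite sizeP.
  have := sr _ (lsubmx v); rewrite -/x; move: (size x) => s; lia.
have y0 : y = 0.
  move: xy0; rewrite x0 mul0r add0r => /eqP; rewrite mulf_eq0 => /orP [/eqP //|].
  by rewrite -size_poly_eq0 sizeP.
by rewrite -(rVpolyK (lsubmx v)) -(rVpolyK (rsubmx v)) -/x -/y x0 y0 !linear0 row_mx0.
Qed.

(** L is nonzero, so 1 is not in A; this makes the final inequality strict. *)
Lemma hilb0 : (0 < hilb 0)%N.
Proof.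
rewrite lt0n mxrank_eq0; apply/eqP => h0.
have [F LF] := L_neq0; case/eqP: LF.
have h1 := crdK (filC D (1 : R)).
have : crd D 1%:P%:P *m G = 0.
  have /submxP [u ->] : (crd D 1%:P%:P <= filmx 0)%MS.
    by apply/filmxP; rewrite h1 filC.
  by rewrite -mulmxA h0 mulmx0.
move/annih_gram; rewrite h1 => /(_ F).
by rewrite !polyC1 mul1r.
Qed.

Lemma topideal_compare j t : (0 < j <= k)%N -> (j + t <= D)%N -> topideal j != 0 ->
  (\rank (topideal j) + t <= \rank (topideal (j + t)))%N.
Proof.
move=> jk; elim: t => [|t IH] jt I0; first by rewrite !addn0.
rewrite addnS in jt; have h := IH (ltnW jt) I0.
rewrite !addnS; apply: (leq_ltn_trans h); apply: topideal_grow => //.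
rewrite -mxrank_eq0 -lt0n; apply: leq_trans h.
by rewrite addn_gt0 lt0n mxrank_eq0 I0.
Qed.

(* By [hilb_step] this says that the increment of [hilb] at D.+1 - j is at most
   its increment at j. *)
Lemma topideal_dual j : (0 < j <= k)%N ->
  (\rank (topideal j) + (D.+1 - j) <= \rank (topideal (D.+1 - j)) + j)%N.
Proof.
move=> /andP [j0 jk]; have [I0|I0] := eqVneq (topideal j) 0; last first.
  have := @topideal_compare j (D.+1 - j - j); rewrite j0 jk => /(_ isT).
  rewrite subnKC; last by lia.
  by move=> /(_ _ I0) h; have {}h := h _; have := h ltac:(lia); lia.
(* The bound is (k + 2 - j) + (k - j), one more than required. *)
have := @rank_topideal_coprime (D.+1 - j) ltac:(lia) ltac:(lia).
rewrite I0 mxrank0; move: (\rank _) => r; lia.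
Qed.

(** From t to t + 1 the right side gains the increment at t + 1 and loses that at D - t = D + 1 - (t
    + 1), which is not larger by [topideal_dual]. *)
Lemma hilb_sum t : (t <= k)%N -> (hilb D + hilb 0 <= hilb t + hilb (D - t))%N.
Proof.
elim: t => [|t IH] tk; first by rewrite subn0 addnC.
have {IH} := IH (ltnW tk).
have s1 := @hilb_step t.+1 ltac:(lia); have s2 := @hilb_step (D.+1 - t.+1) ltac:(lia).
have := @topideal_dual t.+1 ltac:(lia).
move: s1 s2; rewrite !subSS /= -subnS; move: (hilb _) (hilb _) (hilb _) (hilb _) (hilb _) (\rank _) (\rank _).
lia.
Qed.

Lemma hilb_double : (hilb D < 2 * hilb k)%N.
Proof.
have := hilb_sum (leqnn k); rewrite addnK; have := hilb0; lia.
Qed.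

(** Modulo A everything reduces to the span of N monomials, so the N + 1 powers 1, y, ..., y^N are
    dependent. *)
Lemma annih_univariate : exists2 a : {poly R}, a != 0 & A (map_poly polyC a).
Proof.
have [red redP] := choice annih_reduce.
pose M : 'M[R]_(N.+1, N) := \matrix_(i < N.+1) crd D (red 'X^i).
have [v /sub_kermxP vM v0] : exists2 v : 'rV_N.+1, (v <= kermx M)%MS & v != 0.
  apply/rowV0Pn; rewrite -mxrank_eq0 mxrank_ker -lt0n subn_gt0 ltnS.
  exact: rank_leq_col.
exists (rVpoly v); first by apply: contraNneq v0 => v0; rewrite -(rVpolyK v) v0 linear0.
have redF i : fil D (red 'X^i) by case: (redP 'X^i).
have polE : pol (v *m M) = \sum_(i < N.+1) (v 0 i)%:P%:P * red 'X^i.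
  exact: pol_rows.
have vE : map_poly polyC (rVpoly v) = \sum_(i < N.+1) (v 0 i)%:P%:P * 'X^i.
  rewrite /rVpoly poly_def rmorph_sum; apply: eq_bigr => i _.
  by rewrite valK -mul_polyC rmorphM /= map_polyC /= map_polyXn.
have -> : map_poly polyC (rVpoly v) =
    \sum_(i < N.+1) (v 0 i)%:P%:P * ('X^i - red 'X^i).
  rewrite vE; under [RHS]eq_bigr do rewrite mulrBr.
  by rewrite sumrB -polE vM pol0 subr0.
apply: (big_ind A); [exact: annih0 | exact: annihD |] => i _.
by apply: annihM; case: (redP 'X^i).
Qed.

Lemma hilb_rank : hilb D = \rank G.
Proof.
rewrite /hilb; suff -> : filmx D = 1%:M by rewrite mul1mx.
apply/matrixP => a b; rewrite !mxE mexp_le; by case: eqP.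
Qed.

(** * Positivity against the square root of -1 *)

Hypotheses (pN0 : forall x y, p.[y%:P].[x] != 0)
  (Lpos : forall H, fil k H -> 0 <= L (H * H)).

(** [psd_rank_half] applies with [rho] the multiplication by j followed by reduction to degree at
    most D: it is self-adjoint for L(uv), and j^2 = -1 modulo A. *)
Lemma hilb_half : (2 * hilb k <= hilb D)%N.
Proof.
have [a a0 Aa] := annih_univariate.
have [j Aj] := sqrtN1_mod_ideal annihD annihM a0 Aa annihp pN0.
have [red redP] := choice annih_reduce.
pose rho : 'M[R]_N := \matrix_b crd D (red (j * mon R b)).
have redF b : fil D (red (j * mon R b)) by case: (redP (j * mon R b)).
have rhoA (u : 'rV_N) : A (j * pol u - pol (u *m rho)).
  rewrite pol_rows // polE mulr_sumr -sumrB.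
  apply: (big_ind A); [exact: annih0 | exact: annihD |] => b _.
  have -> : j * ((u 0 b)%:P%:P * mon R b) - (u 0 b)%:P%:P * red (j * mon R b) =
    (u 0 b)%:P%:P * (j * mon R b - red (j * mon R b)) by ring.
  by apply: annihM; case: (redP (j * mon R b)).
have rhoL (u v : 'rV_N) : L (pol (u *m rho) * pol v) = L (j * pol u * pol v).
  by apply/esym/eqP; rewrite -subr_eq0 -linSB // -mulrBl rhoA.
have bform_ext (X Y : 'M[R]_N) : (forall u v, bform X u v = bform Y u v) -> X = Y.
  move=> h; apply/matrixP => b c; have := h (delta_mx 0 b) (delta_mx 0 c).
  by rewrite !bform_row -!rowE !mxE.
rewrite hilb_rank; apply: (@psd_rank_half _ _ _ G rho).
- exact: gram_sym.
- apply: bform_ext => u v.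
  have -> : bform (rho *m G) u v = bform G (u *m rho) v by rewrite /bform mulmxA.
  have -> : bform (G *m rho^T) u v = bform G u (v *m rho).
    by rewrite /bform trmx_mul !mulmxA.
  rewrite (bform_gram (u *m rho) v Llin) (bform_gram u (v *m rho) Llin).
  apply: etrans (rhoL u v) _; rewrite mulrAC; apply: etrans (esym (rhoL v u)) _.
  by congr L; apply: mulrC.
- apply: bform_ext => u v.
  have -> : bform (rho *m rho *m G) u v = L (pol (u *m rho) * (j * pol v)).
    have -> : bform (rho *m rho *m G) u v = bform G (u *m rho *m rho) v.
      by rewrite /bform !mulmxA.
    apply: etrans (bform_gram _ _ Llin) _; apply: etrans (rhoL _ _) _.
    by congr L; rewrite -mulrA mulrCA.
  have -> : bform (- G) u v = - L (pol u * pol v).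
    by rewrite -(bform_gram u v Llin) /bform mulmxN mulNmx mxE.
  apply/eqP; rewrite -addr_eq0 -linSD //; apply/eqP.
  have -> : pol (u *m rho) * (j * pol v) + pol u * pol v =
    (j ^+ 2 + 1) * (pol u * pol v) - (j * pol u - pol (u *m rho)) * (j * pol v).
    by move: (pol u) (pol v) (pol _) => x y z; ring.
  by rewrite linSB // Aj rhoA subr0.
- split; first by rewrite !trmx_mul trmxK gram_sym mulmxA.
  move=> x; have -> : bform (filmx k *m G *m (filmx k)^T) x x = bform G (x *m filmx k) (x *m filmx k).
    by rewrite /bform trmx_mul !mulmxA.
  by rewrite bform_gram // Lpos //; apply/filmxP; rewrite submxMl.
Qed.

Lemma no_positive_functional : False.
Proof. by have := hilb_double; have := hilb_half; lia. Qed.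

End Quotient.

(** * The theorem *)

Section Core.
Variable R : realType.
Local Notation S := {poly {poly R}}.

(** The conditions on [p] exclude real zeros at (1 : 0 : 0), at the other points at infinity, and in
    the affine plane, in this order. *)
Lemma no_feasible (k : nat) (p : S) (lam : S -> R) : (1 < k)%N -> fil k.+2 p ->
  size (top k.+2 p) = k.+3 -> (forall x, ~~ root (top k.+2 p) x) ->
  (forall x y, p.[y%:P].[x] != 0) ->
  ~ feasible k (fun F => exists2 H, fil (k - 2) H & F = p * H) lam.
Proof.
move=> k1 hp sP Pr pN0 /extremal_exists [lam' fs ex].
have k0 : (0 < k)%N by apply: ltnW.
have P0 : top k.+2 p != 0 by rewrite -size_poly_eq0 sP.
have kk : (k + k = k.+2 + (k - 2))%N by lia.
have [z Pz F [H hH ->]|q [hq rq] cPq] := radical_coprime k0 fs ex P0 Pr.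
  by rewrite /evalC kk topM // rmorphM hornerM (rootP Pz) mul0r.
have [lin Kl pos [F0 hF0 F0N]] := fs.
have n1 : (1 < k.+2)%N by [].
have DE : (k + k).+2 = (k.+2 + k)%N by lia.
have lamp H : fil (k + k - k.+2) H -> lam' (p * H) = 0.
  by move=> hH; apply: Kl; exists H => //; move: hH; rewrite kk addKn.
have lamq H : fil (k + k - k) H -> lam' (q * H) = 0 by rewrite addnK => /rq.
have [L [Llin LE Lp Lq]] := extend_functional n1 k1 DE hp hq sP cPq lin lamp lamq.
apply: (no_positive_functional k1 hp hq sP cPq Llin Lp Lq _ pN0).
  by exists F0; rewrite LE.
by move=> H hH; rewrite LE ?pos // filM.
Qed.

End Core.

(** * Ternary forms and polynomials in two variables *)

Section Dehomogenization.
Variable R : realType.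
Local Notation S := {poly {poly R}}.
Implicit Types (f g : {mpoly R[3]}) (F H : S) (m : 'X_{1..3}).

Local Notation i0 := (@Ordinal 3 0 isT).
Local Notation i1 := (@Ordinal 3 1 isT).
Local Notation i2 := (@Ordinal 3 2 isT).

(** The default value 1 of [nth] is the image of the third variable. *)
Definition affine_coord (i : 'I_3) : S := nth 1 [:: 'X%:P; 'X] i.
Definition dehom : {mpoly R[3]} -> S := mmap (polyC \o polyC) affine_coord.
HB.instance Definition _ := GRing.RMorphism.on dehom.

Lemma big_ord3 (T : Type) (idx : T) (op : Monoid.law idx) (E : 'I_3 -> T) :
  \big[op/idx]_i E i = op (E i0) (op (E i1) (E i2)).
Proof.
rewrite !big_ord_recl big_ord0 Monoid.mulm1.
by congr (op (E _) (op (E _) (E _))); apply: val_inj.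
Qed.

Lemma mdeg3 m : mdeg m = (m i1 + m i0 + m i2)%N.
Proof. by rewrite mdegE big_ord3 /= addnCA addnA. Qed.

Lemma homog_exp e f m : f \is e.-homog -> m \in msupp f ->
  (m i1 + m i0 + m i2 = e)%N.
Proof. by move=> /dhomogP h /h <-; rewrite -mdeg3. Qed.

Lemma dehomE f :
  dehom f = \sum_(m <- msupp f) (f@_m)%:P%:P * mono R (m i1) (m i0).
Proof.
rewrite /dehom /mmap; apply: eq_bigr => m _; congr (_ * _).
by rewrite /mmap1 big_ord3 /= /affine_coord /= expr1n mulr1 /mono rmorphXn.
Qed.

Lemma coef_dehom f i j : (dehom f)`_i`_j =
  \sum_(m <- msupp f) f@_m * ((i == m i1) && (j == m i0))%:R.
Proof.
by rewrite dehomE !coef_sum; apply: eq_bigr => m _; rewrite coefZS coef_mono.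
Qed.

Lemma fil_dehom e f : f \is e.-homog -> fil e (dehom f).
Proof.
move=> hf; apply/filP => i j ij; rewrite coef_dehom big_seq big1 // => m mf.
case: eqP => //= h1; rewrite ?mulr0 //; case: eqP => h2; rewrite ?mulr0 //.
by have := homog_exp hf mf; rewrite -h1 -h2; lia.
Qed.

(** The degree e and the first two exponents determine the third, so no two monomials of f merge. *)
Lemma dehom_inj e f : f \is e.-homog -> dehom f = 0 -> f = 0.
Proof.
move=> hf f0; apply/mpolyP => m; rewrite mcoeff0; apply/eqP; rewrite mcoeff_eq0.
apply/negP => mf; have := coef_dehom f (m i1) (m i0); rewrite f0 !coef0.
rewrite (bigD1_seq m) ?msupp_uniq //= !eqxx mulr1 big_seq_cond big1.
  by move/esym/eqP; rewrite addr0 mcoeff_eq0 mf.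
move=> m' /andP [m'f mm']; case: eqP => h1; rewrite ?mulr0 //=.
case: eqP => h2; rewrite ?mulr0 //; case/eqP: mm'.
have := homog_exp hf mf; have := homog_exp hf m'f.
rewrite -h1 -h2 => d1 d2; apply/mnmP => -[[|[|[|//]]] hi] /=.
- by rewrite (_ : Ordinal hi = i0) //; apply: val_inj.
- by rewrite (_ : Ordinal hi = i1) //; apply: val_inj.
- by rewrite (_ : Ordinal hi = i2); [lia | apply: val_inj].
Qed.

Lemma horner_dehom f x y : (dehom f).[y%:P].[x] = f.@[nth 1 [:: x; y]].
Proof.
rewrite dehomE mevalE !horner_sum; apply: eq_bigr => m _.
by rewrite big_ord3 /= expr1n mulr1 /mono !(hornerM, hornerC, hornerXn, horner_exp).
Qed.

Lemma top_mono e i j : top e (mono R i j) = if e == (i + j)%N then 'X^j else 0.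
Proof.
apply/polyP => l; rewrite coef_top coef_mono.
have [->|E] := eqVneq e (i + j)%N; rewrite ?coef0 ?coefXn.
  case: leqP => le; last by rewrite (_ : (l == j) = false) //; lia.
  by congr ((nat_of_bool _)%:R); lia.
by case: leqP => // le; rewrite (_ : _ && _ = false) //; lia.
Qed.

(** By the default value 0, the point is (x, 1, 0); in [lead_top_dehom] it is (1, 0, 0). *)
Lemma horner_top_dehom e f x : f \is e.-homog ->
  (top e (dehom f)).[x] = f.@[nth 0 [:: x; 1]].
Proof.
move=> hf; rewrite dehomE top_sum mevalE horner_sum !big_seq.
apply: eq_bigr => m mf; rewrite topZ hornerZ top_mono big_ord3 /= expr1n mul1r.
congr (_ * _); rewrite -(homog_exp hf mf).
rewrite -[X in _ == X]addn0 eqn_add2l.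
case: (m i2) => [|c]; first by rewrite eqxx hornerXn expr0 mulr1.
by rewrite expr0n /= mulr0 horner0.
Qed.

Lemma lead_top_dehom e f : f \is e.-homog ->
  (top e (dehom f))`_e = f.@[nth 0 [:: 1]].
Proof.
move=> hf; rewrite coef_top leqnn subnn coef_dehom mevalE !big_seq.
apply: eq_bigr => m mf; congr (_ * _); have := homog_exp hf mf; rewrite big_ord3 /= expr1n mul1r.
case: (m i1) => [|a]; case: (m i2) => [|c] //=; rewrite ?expr0n ?mulr0 ?mul0r ?mulr1 //=.
- by rewrite add0n addn0 => ->; rewrite eqxx.
- by move=> <-; rewrite (_ : _ == _ = false) //; lia.
Qed.

(* z^e F(x / z, y / z), for F of total degree at most e. *)
Definition rehom e F : {mpoly R[3]} := \sum_(a < nmon e)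
  F`_(mexp a).1`_(mexp a).2 *:
    ('X_i0 ^+ (mexp a).2 * 'X_i1 ^+ (mexp a).1 * 'X_i2 ^+ (e - ((mexp a).1 + (mexp a).2))).

Lemma rehom_homog e F : rehom e F \is e.-homog.
Proof.
apply: rpred_sum => a _; apply: rpredZ.
set b := (mexp a).2; set c := (mexp a).1; set r := (e - _)%N.
have <- : (1 * b + 1 * c + 1 * r)%N = e by have := mexp_le a; rewrite /b /c /r; lia.
by apply: dhomogM; [apply: dhomogM|]; apply: dhomogMn; rewrite dhomogX; apply/eqP/mdeg1.
Qed.

Lemma dehomZ c f : dehom (c *: f) = c%:P%:P * dehom f.
Proof. exact: mmapZ. Qed.

Lemma dehomXi i : dehom 'X_i = affine_coord i.
Proof. by rewrite /dehom mmapX mmap1U. Qed.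

Lemma rehomK e F : fil e F -> dehom (rehom e F) = F.
Proof.
move=> hF; rewrite -[RHS](crdK hF) polE rmorph_sum; apply: eq_bigr => a _.
rewrite /= dehomZ crdE; congr (_ * _).
rewrite !rmorphM !rmorphXn /= !dehomXi /affine_coord /= expr1n mulr1.
by rewrite monE /mono rmorphXn.
Qed.

Lemma rehom_lin e c F H : rehom e (c%:P%:P * F + H) = c *: rehom e F + rehom e H.
Proof.
rewrite /rehom scaler_sumr -big_split; apply: eq_bigr => a _ /=.
by rewrite scalerA -scalerDl coefD coefD coefZS.
Qed.

Lemma dehomK e f : f \is e.-homog -> rehom e (dehom f) = f.
Proof.
move=> hf; apply/eqP; rewrite -subr_eq0; apply/eqP; apply: (@dehom_inj e).
  by rewrite rpredB // rehom_homog.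
by rewrite rmorphB /= rehomK ?subrr // fil_dehom.
Qed.

End Dehomogenization.

Theorem theorem2p7 (R : realType) (d : nat) (hd : (1 <= d)%N)
    (l : {scalar 'Form[R]_(4 * d)}) (I : {pred {mpoly R[3]}})
    (hI : positive_gorenstein_ideal l I) :
  ~ exists p : {mpoly R[3]},
      [/\ p \is (2 * d + 2).-homog, p \in I & strictly_positive p].
Proof.
case: hI => [[[f lf] _ memI] pos] [p [hp pI pP]].
(* Since d >= 1, 2d + 2 does not exceed 4d, and p is not in I merely by its degree. *)
have {memI} [|[dl lp]] := (memI _ _ hp).1 pI; first by lia.
have valh k (g : {mpoly R[3]}) : g \is k.-homog -> mpoly_of_dhomog (indhomog k g) = g.
  by move=> hg; rewrite -[LHS]/(val _) /indhomog insubdK.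
have hhom k (g : 'Form[R]_k) : mpoly_of_dhomog g \is k.-homog by exact: dhomog_is_dhomog.
have lE (g : {mpoly R[3]}) (h : 'Form[R]_(4 * d)) : mpoly_of_dhomog h = g ->
    l (indhomog (4 * d) g) = l h.
  by move=> <-; congr (l _); apply: val_inj; apply: valh.
pose k := (2 * d)%N; have kk : (4 * d = k + k)%N by rewrite /k; lia.
have kn : (2 * d + 2 = k.+2)%N by rewrite /k; lia.
have fp : fil k.+2 (dehom p) by rewrite -kn; apply: fil_dehom.
have tp x : (top k.+2 (dehom p)).[x] = p.@[nth 0 [:: x; 1]].
  by rewrite -kn; apply: horner_top_dehom.
(* [rehom] discards monomials of degree above 4d, so [lam] is defined and linear on all of
   R[x, y]. *)
pose lam F := l (indhomog (4 * d) (rehom (4 * d) F)).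
have lam_dehom g : g \is (4 * d).-homog -> lam (dehom g) = l (indhomog (4 * d) g).
  by move=> hg; rewrite /lam dehomK.
apply: (@no_feasible R k (dehom p) lam) => //.
- by rewrite /k; lia.
(* Strict positivity is used at (1, 0, 0), then at (x, 1, 0), then at (x, y, 1). *)
- apply/eqP; rewrite eqn_leq size_top ltnNge; apply/negP => /leq_sizeP /(_ _ (leqnn _)).
  rewrite -kn (lead_top_dehom hp) => p0.
  have := pP (nth 0 [:: 1]); rewrite p0 ltxx => h.
  by apply: notF; apply: h; exists (@Ordinal 3 0 isT); rewrite /= oner_eq0.
- move=> x; rewrite rootE tp gt_eqF //; apply: pP.
  by exists (@Ordinal 3 1 isT); rewrite /= oner_eq0.
- move=> x y; rewrite horner_dehom gt_eqF //; apply: pP.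
  by exists (@Ordinal 3 2 isT); rewrite /= oner_eq0.
split.
- move=> c F H; rewrite /lam rehom_lin.
  rewrite (lE _ (c *: indhomog (4 * d) (rehom (4 * d) F) + indhomog (4 * d) (rehom (4 * d) H))).
    by rewrite linearP.
  rewrite linearP /= !valh ?rehom_homog //.
- move=> _ [H hH ->].
  have hr := rehom_homog (k - 2) H.
  have e4 : (4 * d - (2 * d + 2) = k - 2)%N by rewrite /k; lia.
  rewrite -(rehomK hH) -rmorphM lam_dehom; last first.
    have -> : (4 * d = (2 * d + 2) + (k - 2))%N by rewrite /k; lia.
    exact: dhomogM.
  rewrite -e4 in hr *.
  by have := lp (indhomog _ (rehom (4 * d - (2 * d + 2)) H)); rewrite valh.
- move=> H hH; have hr := rehom_homog k H.
  rewrite -(rehomK hH) -rmorphM lam_dehom; last by rewrite kk; apply: dhomogM.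
  by have := pos (indhomog _ (rehom k H)); rewrite valh // expr2.
exists (dehom (mpoly_of_dhomog f)); first by rewrite -kk; apply: fil_dehom.
by rewrite lam_dehom // (lE _ f).
Qed.
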